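(* Let $d\ge 1$, $q\ge 1$ be integers, let $m_1,\dots,m_d$ be positive integers with $m_1+\dots+m_d=q$, and let $\lambda_1,\dots,\lambda_d$ be non-zero real numbers. Let $N_1,\dots,N_q$ be independent standard normal random variables and consider $$F=\sum_{i=1}^{m_1}\lambda_1(N_i^2-1)+\sum_{i=m_1+1}^{m_1+m_2}\lambda_2(N_i^2-1)+\dots+\sum_{i=m_1+\dots+m_{d-1}+1}^{q}\lambda_d(N_i^2-1).$$ Let $Y$ be a real valued random variable with $\mathbb{E}[|Y|]<+\infty$. Then $Y$ and $F$ have the same law if and only if, for all $\phi\in S(\mathbb{R})$, $$\mathbb{E}\Bigg[\Big(Y+\sum_{i=1}^d\lambda_im_i\Big)(-1)^d2^d\Big(\prod_{j=1}^d\lambda_j\Big)\phi^{(d)}(Y)+\sum_{l=1}^{d-1}2^l(-1)^l\bigg(Y\,e_l(\lambda_1,\dots,\lambda_d)+\sum_{k=1}^d\lambda_km_k\big(e_l(\lambda_1,\dots,\lambda_d)-e_l(\underline{\lambda}_k)\big)\bigg)\phi^{(l)}(Y)+Y\phi(Y)\Bigg]=0.$$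
   Context: For a tuple $(x_1,\dots,x_n)$ of real numbers and $1\le k\le n$, $e_k(x_1,\dots,x_n)=\sum_{1\le i_1<\dots<i_k\le n}x_{i_1}\cdots x_{i_k}$ is the elementary symmetric polynomial of order $k$, and $e_0=1$. For $k\in\{1,\dots,d\}$, $\underline{\lambda}_k=(\lambda_1,\dots,\lambda_{k-1},\lambda_{k+1},\dots,\lambda_d)$ is the $(d-1)$-tuple obtained by removing $\lambda_k$. $S(\mathbb{R})$ is the Schwartz space, and $\phi^{(l)}$ is the $l$-th derivative. For $d=1$ the sum over $l$ is empty. *)

(* Defs.v *)
From HB Require Import structures.
From mathcomp Require Import all_boot all_order all_algebra.
From mathcomp.multinomials Require mpoly.
From mathcomp Require Import all_classical all_reals all_analysis.

(* Only the structure instances of mpoly: its notations clash with those of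
   mathcomp-analysis. *)
Import (canonicals) mpoly.

Set Implicit Arguments.
Unset Strict Implicit.
Unset Printing Implicit Defensive.

Import Order.TTheory GRing.Theory Num.Theory.
Import numFieldNormedType.Exports.

Local Open Scope classical_set_scope.
Local Open Scope ring_scope.

Definition elem_sym (R : comNzRingType) (n : nat) (x : 'I_n -> R) (k : nat) : R :=
  mpoly.meval x (mpoly.mesym n R k).

Lemma elem_symE (R : comNzRingType) (n : nat) (x : 'I_n -> R) (k : nat) :
  elem_sym x k = \sum_(A : {set 'I_n} | #|A| == k) \prod_(i in A) x i.
Proof.
rewrite /elem_sym /mpoly.mesym rmorph_sum /=; apply: eq_bigr => A _.
by rewrite rmorph_prod /=; apply: eq_bigr => i _; exact: mpoly.mevalXU.
Qed.

Definition del_coord (T : Type) (d : nat) (x : 'I_d -> T) (k : 'I_d) :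
  'I_d.-1 -> T := fun j => x (lift k j).

Definition schwartz (R : realType) (phi : R -> R) : Prop :=
  (forall (n : nat) (x : R), derivable (derive1n n phi) x 1) /\
  (forall m n : nat, exists C : R, forall x : R, `|x ^+ m * derive1n n phi x| <= C).

(* A measure of the library is a function on all sets that is constrained on
   the measurable ones only, so laws are compared on measurable sets. *)
Definition same_law (R : realType)
    (d1 d2 : measure_display) (T1 : measurableType d1) (T2 : measurableType d2)
    (P1 : probability T1 R) (P2 : probability T2 R)
    (X1 : {RV P1 >-> R}) (X2 : {RV P2 >-> R}) : Prop :=
  forall A : set R, measurable A ->
    distribution P1 X1 A = distribution P2 X2 A.

Definition standard_normal (R : realType) (d : measure_display)
    (T : measurableType d) (P : probability T R) (X : {RV P >-> R}) : Prop :=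
  forall A : set R, measurable A ->
    distribution P X A = normal_prob (0 : R) 1 A.

Definition mutually_independent (R : realType) (d : measure_display)
    (T : measurableType d) (P : probability T R) (I : finType)
    (X : I -> {RV P >-> R}) : Prop :=
  forall (J : {set I}) (A : I -> set R), (forall i, measurable (A i)) ->
    P (\bigcap_(i in [set` J]) (X i @^-1` A i)) =
      (\prod_(i in J) P (X i @^-1` A i))%E.

(* Main.v *)
(* Let D be the derivation, p = prod_k (1 - 2 lambda_k X) and
   q = sum_k lambda_k m_k (p - p_k), where p_k omits the k-th factor. The
   bracket of the Stein equation is Y (p(D) phi)(Y) + (q(D) phi)(Y).

   If Y has the law of F, Gaussian integration by parts in N_i, the other
   variables being frozen by independence, gives
     E[(N_i^2 - 1) ((1 - 2 lambda D) f)(F)] = 2 lambda E[f'(F)],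
   where lambda is the weight of N_i. Take f = p_k(D) phi for the block k of i,
   multiply by lambda and sum over i.

   Conversely, the equation extends from Schwartz functions to cos (t x) and
   sin (t x) by multiplying them with exp (- (a x)^2) and letting a tend to 0.
   It then says that the characteristic function psi of Y satisfies
   psi' = g psi, where Re g(t) has the sign of - t. The difference of the
   characteristic functions of Y and F solves the same equation and vanishes
   at 0, so its modulus, decreasing in |t|, is zero.

   A characteristic function determines the law: integrating against exp (- s)
   gives the expectation of Cauchy kernels, integrating these in their centre
   gives the expectation of arctangents, and a limit of arctangents is a step
   function. *)
Require Import Defs.
From HB Require Import structures.
From mathcomp Require Import all_boot all_order all_algebra.
From mathcomp Require Import all_classical all_reals all_analysis.
From mathcomp Require Import measurable_realfun.
From mathcomp.real_closed Require Import complex.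
From mathcomp Require Import ring lra.

Set Implicit Arguments.
Unset Strict Implicit.
Unset Printing Implicit Defensive.

Import Order.TTheory GRing.Theory Num.Theory.
Import numFieldNormedType.Exports.

Local Open Scope classical_set_scope.
Local Open Scope ring_scope.

(** * Derivatives, and polynomials in the derivation *)

(** Integration by parts trades [N_i^2 - 1] for [2 lambda N_i^2] in front of a derivative. Writing
    [N_i^2 = (N_i^2 - 1) + 1] moves one piece back to the left, whence the factor [1 - 2 lambda D].
    It depends on the weight only: one factor serves the [m_k] variables of a block, and the order
    of the operator is [d], not [q].

    The characteristic function of [F] is never computed: [F] and [Y] are compared through the
    equation that both satisfy. Its leading coefficient [p (i t)] never vanishes, each factor
    [1 - 2 i lambda_k t] having real part 1, and block [k] adds [- 2 m_k lambda_k^2 t / (1 + 4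
    lambda_k^2 t^2)] to [Re g], whatever the sign of [lambda_k].

    Cosines are not Schwartz functions and only a first moment of [Y] is available; a dominating
    function of linear growth, common to all cutoffs, makes the limit legitimate.

    In the uniqueness of laws, exchanges of integrals are replaced by differentiation in a
    parameter: two integrals with equal derivatives differ by a constant, identified at one end of
    the parameter range. *)

Section derivative_rules.
Context {R : realType}.
Implicit Types (f g : R -> R) (x a b c : R).

Lemma is_derive_mul f g x a b : is_derive x 1 f a -> is_derive x 1 g b ->
  is_derive x 1 (fun y => f y * g y) (a * g x + f x * b).
Proof.
move=> df dg; apply: (is_derive_eq (is_deriveM df dg)).
by rewrite addrC /GRing.scale/= [g x * a]mulrC.
Qed.

Lemma is_derive_add f g x a b : is_derive x 1 f a -> is_derive x 1 g b ->
  is_derive x 1 (fun y => f y + g y) (a + b).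
Proof. exact: is_deriveD. Qed.

Lemma is_derive_scale c f x a : is_derive x 1 f a ->
  is_derive x 1 (fun y => c * f y) (c * a).
Proof. exact: is_deriveZ. Qed.

Lemma is_derive_bigsum n (h : 'I_n -> R -> R) (dh : 'I_n -> R) x :
  (forall i, is_derive x 1 (h i) (dh i)) ->
  is_derive x 1 (fun y => \sum_(i < n) h i y) (\sum_(i < n) dh i).
Proof.
move=> dhx; rewrite (_ : (fun y => _) = \sum_(i < n) h i); first exact: is_derive_sum.
by apply/funext => y; rewrite fct_sumE.
Qed.

Lemma is_derive_comp f g x a b : is_derive x 1 g b -> is_derive (g x) 1 f a ->
  is_derive x 1 (fun y => f (g y)) (a * b).
Proof. by move=> dg df; exact: is_derive1_comp. Qed.

Lemma is_derive_affine a b x : is_derive x 1 (fun y => a * y + b) a.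
Proof.
rewrite -[X in is_derive _ _ _ X]mulr1 -[X in is_derive _ _ _ X]addr0.
exact: (is_derive_add (is_derive_scale a (is_derive_id x 1)) (is_derive_cst b x 1)).
Qed.

Lemma is_derive_derive1 f x a : is_derive x 1 f a -> derive1 f x = a.
Proof. by move=> df; rewrite derive1E; apply: derive_val. Qed.

Lemma derive1_is_derive f x : derivable f x 1 -> is_derive x 1 f (derive1 f x).
Proof. by move=> df; rewrite derive1E; apply: DeriveDef. Qed.

Lemma is_derive_continuous f x a : is_derive x 1 f a -> {for x, continuous f}.
Proof.
by move=> df; apply: differentiable_continuous; apply/derivable1_diffP; case: df.
Qed.

Lemma continuous_fun_comp (g f : R -> R) :
  continuous g -> continuous f -> continuous (fun x => g (f x)).
Proof. by move=> cg cf x; exact: (continuous_comp (cf x) (cg (f x))). Qed.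

End derivative_rules.

Section smooth_functions.
Context {R : realType}.
Implicit Types (f g : R -> R) (x : R) (p q : {poly R}).

Definition smooth f := forall n x, derivable (derive1n n f) x 1.

(** Together with [smooth] this gives a class containing both the Schwartz functions and the
    functions [cos (t * x)], [sin (t * x)]. The equation for [F] is proved once on this class and
    serves in both implications. *)
Definition bounded_derivatives f :=
  forall n, exists C : R, forall x, `|derive1n n f x| <= C.

Lemma smooth_is_derive f n x : smooth f ->
  is_derive x 1 (derive1n n f) (derive1n n.+1 f x).
Proof. by move=> sf; rewrite derive1nS; exact: derive1_is_derive. Qed.

(** The closed forms of iterated derivatives below (products, dilations, trigonometric functions,
    [gauss]) all come from guessing the whole sequence and checking one step. *)
Lemma derive1n_seq (F : nat -> R -> R) :
  (forall n x, is_derive x 1 (F n) (F n.+1 x)) ->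
  forall n, derive1n n (F 0%N) = F n.
Proof.
move=> dF; elim=> [//|n IH]; rewrite derive1nS IH; apply/funext => x.
exact: is_derive_derive1.
Qed.

Lemma smooth_seq (F : nat -> R -> R) :
  (forall n x, is_derive x 1 (F n) (F n.+1 x)) -> smooth (F 0%N).
Proof. by move=> dF n x; rewrite derive1n_seq//; case: (dF n x). Qed.

Lemma derive1n_add f m n : derive1n n (derive1n m f) = derive1n (n + m) f.
Proof. by rewrite /derive1n iterD. Qed.

Lemma smooth_derive1n f m : smooth f -> smooth (derive1n m f).
Proof. by move=> sf n x; rewrite derive1n_add; exact: sf. Qed.

Lemma smooth_continuous f : smooth f -> continuous f.
Proof. by move=> sf x; exact: is_derive_continuous (smooth_is_derive 0 x sf). Qed.

Let leibniz f g n x := \sum_(i < n.+1)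
  'C(n, i)%:R * (derive1n i f x * derive1n (n - i) g x).

Let leibniz_derive f g n x : smooth f -> smooth g ->
  is_derive x 1 (leibniz f g n) (leibniz f g n.+1 x).
Proof.
move=> sf sg; apply: is_derive_eq.
  apply: is_derive_bigsum => i; apply: is_derive_scale.
  apply: is_derive_mul; exact: smooth_is_derive.
pose T i := derive1n i f x * derive1n (n.+1 - i) g x.
have -> : \sum_(i < n.+1) 'C(n, i)%:R * (derive1n i.+1 f x * derive1n (n - i) g x
     + derive1n i f x * derive1n (n - i).+1 g x) =
    \sum_(i < n.+1) 'C(n, i)%:R * T i.+1 + \sum_(i < n.+1) 'C(n, i)%:R * T i.
  rewrite -big_split; apply: eq_bigr => i _; rewrite /T subSS.
  by rewrite subSn ?mulrDr// -ltnS.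
rewrite /leibniz [RHS]big_ord_recl.
(* The top term added on the right vanishes, its binomial coefficient being that of [n.+1] among
   [n]; Pascal's rule then merges the two sums. *)
have -> : \sum_(i < n.+1) 'C(n, i)%:R * T i =
    T 0%N + \sum_(i < n.+1) 'C(n, i.+1)%:R * T i.+1.
  by rewrite big_ord_recl [in RHS]big_ord_recr/= (@bin_small n n.+1)// mul0r addr0 bin0 mul1r.
rewrite addrCA -big_split bin0 mul1r; congr (_ + _); apply: eq_bigr => i _.
by rewrite /= -mulrDl -natrD addnC -binS.
Qed.

Lemma derive1n_mul f g n x : smooth f -> smooth g ->
  derive1n n (fun y => f y * g y) x = \sum_(i < n.+1)
    'C(n, i)%:R * (derive1n i f x * derive1n (n - i) g x).
Proof.
move=> sf sg; rewrite (_ : (fun y => _) = leibniz f g 0%N).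
  by rewrite (derive1n_seq (fun k y => leibniz_derive k y sf sg)).
by apply/funext => y; rewrite /leibniz big_ord1 bin0 mul1r.
Qed.

Lemma smooth_mul f g : smooth f -> smooth g -> smooth (fun y => f y * g y).
Proof.
move=> sf sg; rewrite (_ : (fun y => _) = leibniz f g 0).
  exact: (smooth_seq (fun k y => leibniz_derive k y sf sg)).
by apply/funext => y; rewrite /leibniz big_ord1 bin0 mul1r.
Qed.

Lemma derive1n_scale f (c : R) n : smooth f ->
  derive1n n (fun y => f (c * y)) = (fun y => c ^+ n * derive1n n f (c * y)).
Proof.
move=> sf; pose F n y := c ^+ n * derive1n n f (c * y).
have dF k x : is_derive x 1 (F k) (F k.+1 x).
  have df := @is_derive_comp _ (derive1n k f) (fun y => c * y) x _ _
    (is_derive_scale c (is_derive_id x 1)) (smooth_is_derive k (c * x) sf).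
  apply: (is_derive_eq (is_derive_scale (c ^+ k) df)).
  by rewrite /F exprSr mulr1; ring.
rewrite -[RHS]/(F n) -(derive1n_seq dF); congr derive1n.
by apply/funext => y; rewrite /F mul1r.
Qed.

Lemma smooth_scale f (c : R) : smooth f -> smooth (fun y => f (c * y)).
Proof.
move=> sf n x; rewrite derive1n_scale//.
case: (is_derive_scale (c ^+ n) (@is_derive_comp _ (derive1n n f) _ x _ _
  (is_derive_scale c (is_derive_id x 1)) (smooth_is_derive n (c * x) sf))) => //.
Qed.

Definition diffop p f x := \sum_(l < size p) p`_l * derive1n l f x.

Lemma diffop_widen p f x n : (size p <= n)%N ->
  diffop p f x = \sum_(l < n) p`_l * derive1n l f x.
Proof.
move=> pn; rewrite /diffop (big_ord_widen _ (fun l => p`_l * derive1n l f x) pn).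
rewrite big_mkcond; apply: eq_bigr => l _; case: ltnP => // ?.
by rewrite nth_default// mul0r.
Qed.

Lemma diffopD p q f x : diffop (p + q) f x = diffop p f x + diffop q f x.
Proof.
rewrite !(@diffop_widen _ _ _ (maxn (size p) (size q))) ?leq_maxl ?leq_maxr ?size_polyD//.
by rewrite -big_split; apply: eq_bigr => l _; rewrite coefD mulrDl.
Qed.

Lemma diffopZ c p f x : diffop (c *: p) f x = c * diffop p f x.
Proof.
rewrite (@diffop_widen _ _ _ (size p)) ?size_scale_leq// mulr_sumr.
by apply: eq_bigr => l _; rewrite coefZ mulrA.
Qed.

Lemma diffop0 f x : diffop 0 f x = 0.
Proof. by rewrite /diffop size_poly0 big_ord0. Qed.

Lemma diffopB p q f x : diffop (p - q) f x = diffop p f x - diffop q f x.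
Proof. by rewrite diffopD -scaleN1r diffopZ mulN1r. Qed.

Lemma diffop_sum (I : Type) (r : seq I) (P : pred I) (p : I -> {poly R}) f x :
  diffop (\sum_(i <- r | P i) p i) f x = \sum_(i <- r | P i) diffop (p i) f x.
Proof.
elim/big_rec2: _ => [|i a b _ <-]; first exact: diffop0.
exact: diffopD.
Qed.

Lemma diffop_derive p f n x : smooth f ->
  is_derive x 1 (diffop p (derive1n n f)) (diffop p (derive1n n.+1 f) x).
Proof.
move=> sf; apply: is_derive_bigsum => l; apply: is_derive_scale.
rewrite !derive1n_add addnS; exact: smooth_is_derive.
Qed.

Lemma derive1n_diffop p f n : smooth f ->
  derive1n n (diffop p f) = diffop p (derive1n n f).
Proof. by move=> sf; exact: (derive1n_seq (fun k y => diffop_derive p k y sf)). Qed.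

Lemma smooth_diffop p f : smooth f -> smooth (diffop p f).
Proof. by move=> sf; exact: (smooth_seq (fun k y => diffop_derive p k y sf)). Qed.

Lemma diffopMX p f x : smooth f -> diffop ('X * p) f x = derive1n 1 (diffop p f) x.
Proof.
move=> sf; rewrite derive1n_diffop// mulrC (@diffop_widen _ _ _ (size p).+1).
  rewrite big_ord_recl coefMX mul0r add0r; apply: eq_bigr => l _.
  by rewrite derive1n_add addn1 lift0 coefMX.
by rewrite (leq_trans (size_polyMleq _ _))// size_polyX addn2.
Qed.

Lemma bounded_diffop p f : smooth f -> bounded_derivatives f ->
  bounded_derivatives (diffop p f).
Proof.
move=> sf bf n; rewrite derive1n_diffop//.
have /choice[C HC] := bf; exists (\sum_(l < size p) `|p`_l| * C (l + n)%N) => x.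
apply: (le_trans (ler_norm_sum _ _ _)); apply: ler_sum => l _.
by rewrite normrM derive1n_add ler_wpM2l.
Qed.

End smooth_functions.

(** * Integration *)

Section integral_rules.
Context {R : realType} d {T : measurableType d} (mu : {measure set T -> \bar R}).
Implicit Types f g : T -> R.

Lemma integrable_dominated f g : mu.-integrable setT (EFin \o g) ->
  measurable_fun setT f -> (forall x, `|f x| <= g x) ->
  mu.-integrable setT (EFin \o f).
Proof.
move=> ig mf fg; apply: (le_integrable measurableT _ _ ig).
  exact/measurable_EFinP.
by move=> x _; rewrite /= lee_fin (le_trans (fg x))// ler_norm.
Qed.

(** The domination is asked only within distance 1 of [a], because the kernel
    [expR (- t) * cos (t * u)] met later has no bound valid for all real [t]. *)
Lemma is_derive_Rintegral (f df : R -> T -> R) (G : T -> R) (a : R) :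
  (forall t, mu.-integrable setT (EFin \o f t)) ->
  (forall (t : R) x, is_derive t 1 (f ^~ x) (df t x)) ->
  mu.-integrable setT (EFin \o G) -> (forall (t : R) x, `|t - a| < 1 -> `|df t x| <= G x) ->
  is_derive a 1 (fun t => \int[mu]_x f t x) (\int[mu]_x df a x).
Proof.
move=> intf dfE intG dfG.
have d1E t x : partial1of2 f t x = df t x.
  by rewrite /partial1of2 derive1E; have := dfE t x => ?; rewrite derive_val.
have G0 x : 0 <= G x.
  by rewrite (le_trans (normr_ge0 (df a x)))// dfG// subrr normr0.
have Ia : `]a - 1, a + 1[%classic a by rewrite /= in_itv/=; apply/andP; split; lra.
have HG t x : `]a - 1, a + 1[%classic t -> setT x -> `|partial1of2 f t x| <= G x.
  rewrite /= in_itv/= => /andP[ta at_] _; rewrite d1E dfG// ltr_norml.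
  by apply/andP; split; lra.
have Hd t x : `]a - 1, a + 1[%classic t -> setT x -> derivable (f ^~ x) t 1.
  by move=> _ _; case: (dfE t x).
have Hi t : `]a - 1, a + 1[%classic t -> mu.-integrable setT (EFin \o f t) by [].
apply: DeriveDef.
  exact: (derivable_under_integral measurableT Ia Hi Hd G0 intG HG).
rewrite -derive1E (differentiation_under_integral measurableT Ia Hi Hd G0 intG HG).
by apply: eq_Rintegral => x _; rewrite d1E.
Qed.

Lemma cvg_Rintegral (f_ : nat -> T -> R) (f G : T -> R) :
  (forall n, measurable_fun setT (f_ n)) -> measurable_fun setT f ->
  mu.-integrable setT (EFin \o G) -> (forall n x, `|f_ n x| <= G x) ->
  (forall x, f_ n x @[n --> \oo] --> f x) ->
  \int[mu]_x f_ n x @[n --> \oo] --> \int[mu]_x f x.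
Proof.
move=> mf_ mf intG fG ff.
have [] := @dominated_convergence _ _ _ mu setT measurableT
  (fun n x => (f_ n x)%:E) (EFin \o f) (EFin \o G).
- by move=> n; exact/measurable_EFinP.
- exact/measurable_EFinP.
- by apply: aeW => x _; apply: cvg_EFin; [exact: nearW|exact: ff].
- exact: intG.
- by apply: aeW => x n _; rewrite /= lee_fin.
- move=> intf _ cvgf; apply: fine_cvg; rewrite /Rintegral fineK//.
  exact: (integrable_fin_num measurableT intf).
Qed.

Lemma integrable_scale (c : R) f : mu.-integrable setT (EFin \o f) ->
  mu.-integrable setT (EFin \o (fun x => c * f x)).
Proof. by move=> intf; exact: (integrableZl measurableT c intf). Qed.

Lemma integrable_add f g : mu.-integrable setT (EFin \o f) ->
  mu.-integrable setT (EFin \o g) ->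
  mu.-integrable setT (EFin \o (fun x => f x + g x)).
Proof. by move=> intf intg; exact: (integrableD measurableT intf intg). Qed.

Lemma Rintegral_lin4 (a1 a2 a3 a4 : R) f1 f2 f3 f4 :
  mu.-integrable setT (EFin \o f1) -> mu.-integrable setT (EFin \o f2) ->
  mu.-integrable setT (EFin \o f3) -> mu.-integrable setT (EFin \o f4) ->
  \int[mu]_x (a1 * f1 x + a2 * f2 x + a3 * f3 x + a4 * f4 x) =
  a1 * (\int[mu]_x f1 x) + a2 * (\int[mu]_x f2 x) + a3 * (\int[mu]_x f3 x)
  + a4 * (\int[mu]_x f4 x).
Proof.
move=> i1 i2 i3 i4; rewrite -!RintegralZl// !RintegralD//;
  do ?[apply: integrable_add | exact: integrable_scale].
Qed.

Lemma Rintegral_sum (I : finType) (h : I -> T -> R) :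
  (forall i, mu.-integrable setT (EFin \o h i)) ->
  \int[mu]_x (\sum_i h i x) = \sum_i \int[mu]_x h i x.
Proof.
move=> ih; rewrite /Rintegral.
under eq_integral do rewrite -sumEFin.
rewrite (@integral_sum _ _ _ mu setT measurableT _ (fun i x => (h i x)%:E))//.
by rewrite sum_fine// => i _; exact: (integrable_fin_num measurableT (ih i)).
Qed.

End integral_rules.
Arguments integrable_dominated {R d T} mu {f} g.
Arguments is_derive_Rintegral {R d T} mu {f} df G a.
Arguments cvg_Rintegral {R d T} mu {f_} f G.


Lemma continuous_bounded_integrable {R : realType} (mu : probability R R)
    (f : R -> R) (a : R) : continuous f ->
  (forall x, `|f x| <= a) -> mu.-integrable setT (EFin \o f).
Proof.
move=> cf fa; apply: (integrable_dominated mu (cst a)) => //.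
  exact: finite_measure_integrable_cst.
exact: continuous_measurable_fun.
Qed.

Lemma Rintegral_prob_cst {R : realType} d (T : measurableType d)
  (mu : probability T R) (c : R) : \int[mu]_(x in setT) c = c.
Proof.
rewrite Rintegral_cst// [X in fine X](_ : _ = 1%E) ?mulr1//.
exact: probability_setT.
Qed.

(** * Characteristic functions *)

Section trigonometric_test_functions.
Context {R : realType}.
Implicit Types (t x : R) (p q : {poly R}) (z w : R[i]).

Lemma ReD z w : complex.Re (z + w) = complex.Re z + complex.Re w. Proof. by case: z => ? ?; case: w. Qed.
Lemma ImD z w : complex.Im (z + w) = complex.Im z + complex.Im w. Proof. by case: z => ? ?; case: w. Qed.
Lemma ReN z : complex.Re (- z) = - complex.Re z. Proof. by case: z. Qed.
Lemma ImN z : complex.Im (- z) = - complex.Im z. Proof. by case: z. Qed.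
Lemma ReM z w : complex.Re (z * w) = complex.Re z * complex.Re w - complex.Im z * complex.Im w.
Proof. by case: z => ? ?; case: w. Qed.
Lemma ImM z w : complex.Im (z * w) = complex.Re z * complex.Im w + complex.Im z * complex.Re w.
Proof. by case: z => ? ?; case: w. Qed.
Lemma Re_sum (I : Type) (r : seq I) (F : I -> R[i]) :
  complex.Re (\sum_(i <- r) F i) = \sum_(i <- r) complex.Re (F i).
Proof. by apply: (big_morph _ ReD). Qed.
Lemma Im_sum (I : Type) (r : seq I) (F : I -> R[i]) :
  complex.Im (\sum_(i <- r) F i) = \sum_(i <- r) complex.Im (F i).
Proof. by apply: (big_morph _ ImD). Qed.

Definition expi t x : R[i] := Complex (cos (t * x)) (sin (t * x)).

(** The Fourier multiplier [p (i t)]: the operator [p(D)] multiplies [exp (i t x)] by it, and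
    [diffop_cos], [diffop_sin] are the real and imaginary parts of this fact. *)
Definition symbol p t : R[i] := (map_poly (real_complex R) p).[Complex 0 t].

Lemma symbolE p t :
  symbol p t = \sum_(l < size p) real_complex R p`_l * Complex 0 t ^+ l.
Proof.
rewrite /symbol horner_coef size_map_poly; apply: eq_bigr => i _.
by rewrite coef_map.
Qed.

Lemma is_derive_costx t x : is_derive x 1 (fun y => cos (t * y)) (- (t * sin (t * x))).
Proof.
have := is_derive_comp (is_derive_scale t (is_derive_id x 1)) (is_derive_cos (t * x)).
by move=> H; apply: (is_derive_eq H); ring.
Qed.

Lemma is_derive_sintx t x : is_derive x 1 (fun y => sin (t * y)) (t * cos (t * x)).
Proof.
have := is_derive_comp (is_derive_scale t (is_derive_id x 1)) (is_derive_sin (t * x)).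
by move=> H; apply: (is_derive_eq H); ring.
Qed.

Let is_derive_Re t n x : is_derive x 1 (fun y => complex.Re (Complex 0 t ^+ n * expi t y))
  (complex.Re (Complex 0 t ^+ n.+1 * expi t x)).
Proof.
rewrite (_ : (fun y => _) = fun y => complex.Re (Complex 0 t ^+ n) * cos (t * y)
   + (- complex.Im (Complex 0 t ^+ n)) * sin (t * y)).
  apply: (is_derive_eq (is_derive_add (is_derive_scale _ (is_derive_costx t x))
    (is_derive_scale _ (is_derive_sintx t x)))).
  by rewrite exprSr !(ReM, ImM)/=; ring.
by apply/funext => y; rewrite ReM/= mulNr.
Qed.

Let is_derive_Im t n x : is_derive x 1 (fun y => complex.Im (Complex 0 t ^+ n * expi t y))
  (complex.Im (Complex 0 t ^+ n.+1 * expi t x)).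
Proof.
rewrite (_ : (fun y => _) = fun y => complex.Re (Complex 0 t ^+ n) * sin (t * y)
   + complex.Im (Complex 0 t ^+ n) * cos (t * y)).
  apply: (is_derive_eq (is_derive_add (is_derive_scale _ (is_derive_sintx t x))
    (is_derive_scale _ (is_derive_costx t x)))).
  by rewrite exprSr !(ReM, ImM)/=; ring.
by apply/funext => y; rewrite ImM.
Qed.

Lemma derive1n_cos t n : derive1n n (fun y => cos (t * y)) =
  fun x => complex.Re (Complex 0 t ^+ n * expi t x).
Proof.
rewrite -(derive1n_seq (is_derive_Re t)); congr derive1n.
by apply/funext => y; rewrite expr0 mul1r.
Qed.

Lemma derive1n_sin t n : derive1n n (fun y => sin (t * y)) =
  fun x => complex.Im (Complex 0 t ^+ n * expi t x).
Proof.
rewrite -(derive1n_seq (is_derive_Im t)); congr derive1n.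
by apply/funext => y; rewrite expr0 mul1r.
Qed.

Lemma smooth_cos t : smooth (fun y => cos (t * y)).
Proof.
rewrite (_ : (fun y => _) = (fun y => complex.Re (Complex 0 t ^+ 0 * expi t y))).
  exact: (smooth_seq (is_derive_Re t)).
by apply/funext => y; rewrite expr0 mul1r.
Qed.

Lemma smooth_sin t : smooth (fun y => sin (t * y)).
Proof.
rewrite (_ : (fun y => _) = (fun y => complex.Im (Complex 0 t ^+ 0 * expi t y))).
  exact: (smooth_seq (is_derive_Im t)).
by apply/funext => y; rewrite expr0 mul1r.
Qed.

Lemma cos_norm_le1 (u : R) : `|cos u| <= 1.
Proof. by rewrite ler_norml cos_geN1 cos_le1. Qed.

Lemma sin_norm_le1 (u : R) : `|sin u| <= 1.
Proof. by rewrite ler_norml sin_geN1 sin_le1. Qed.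

Lemma bounded_derivatives_cos t : bounded_derivatives (fun y => cos (t * y)).
Proof.
move=> n; rewrite derive1n_cos; set z := _ ^+ n; exists (`|complex.Re z| + `|complex.Im z|) => x.
rewrite ReM (le_trans (ler_normB _ _))// !normrM lerD// ler_piMr//=.
  exact: cos_norm_le1.
exact: sin_norm_le1.
Qed.

Lemma bounded_derivatives_sin t : bounded_derivatives (fun y => sin (t * y)).
Proof.
move=> n; rewrite derive1n_sin; set z := _ ^+ n; exists (`|complex.Re z| + `|complex.Im z|) => x.
rewrite ImM (le_trans (ler_normD _ _))// !normrM lerD// ler_piMr//=.
  exact: sin_norm_le1.
exact: cos_norm_le1.
Qed.

Lemma diffop_cos p t x :
  diffop p (fun y => cos (t * y)) x = complex.Re (symbol p t * expi t x).
Proof.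
rewrite symbolE mulr_suml Re_sum /diffop; apply: eq_bigr => l _.
by rewrite derive1n_cos -mulrA [in RHS]ReM/= mul0r subr0.
Qed.

Lemma diffop_sin p t x :
  diffop p (fun y => sin (t * y)) x = complex.Im (symbol p t * expi t x).
Proof.
rewrite symbolE mulr_suml Im_sum /diffop; apply: eq_bigr => l _.
by rewrite derive1n_sin -mulrA [in RHS]ImM/= mul0r addr0.
Qed.

End trigonometric_test_functions.

Section characteristic_function.
Context {R : realType}.
Implicit Types (mu nu : probability R R) (p q : {poly R}).

Definition cos_moment mu (t : R) : R := \int[mu]_x cos (t * x).
Definition sin_moment mu (t : R) : R := \int[mu]_x sin (t * x).

Lemma integrable_cos mu t : mu.-integrable setT (EFin \o (fun x : R => cos (t * x))).
Proof.
apply: (@continuous_bounded_integrable _ mu _ 1) => [|x]; last exact: cos_norm_le1.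
exact/smooth_continuous/smooth_cos.
Qed.

Lemma integrable_sin mu t : mu.-integrable setT (EFin \o (fun x : R => sin (t * x))).
Proof.
apply: (@continuous_bounded_integrable _ mu _ 1) => [|x]; last exact: sin_norm_le1.
exact/smooth_continuous/smooth_sin.
Qed.

Definition stein_op p q (f : R -> R) x := x * diffop p f x + diffop q f x.

Definition stein_trig p q (nu : probability R R) := forall t,
  \int[nu]_x stein_op p q (fun y => cos (t * y)) x = 0 /\
  \int[nu]_x stein_op p q (fun y => sin (t * y)) x = 0.

Section moment1.
Variable mu : probability R R.
Hypothesis mu1 : mu.-integrable setT (EFin \o (id : R -> R)).

Lemma integrable_abs_moment : mu.-integrable setT (EFin \o (fun x : R => `|x|)).
Proof. exact: (integrable_abse mu1). Qed.

Lemma is_derive_cos_moment (t : R) :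
  is_derive t 1 (cos_moment mu) (\int[mu]_x (- (x * sin (t * x)))).
Proof.
apply: (is_derive_Rintegral mu (fun t x => - (x * sin (t * x))) (fun x => `|x|)).
- exact: integrable_cos.
- move=> s x; have := is_derive_costx x s.
  rewrite [X in - (_ * sin X)]mulrC.
  by under [X in is_derive _ _ X _]eq_fun do rewrite mulrC.
- exact: integrable_abs_moment.
- by move=> s x _; rewrite normrN normrM ler_piMr// sin_norm_le1.
Qed.

Lemma is_derive_sin_moment (t : R) :
  is_derive t 1 (sin_moment mu) (\int[mu]_x (x * cos (t * x))).
Proof.
apply: (is_derive_Rintegral mu (fun t x => x * cos (t * x)) (fun x => `|x|)).
- exact: integrable_sin.
- move=> s x; have := is_derive_sintx x s.
  rewrite [X in (_ * cos X)]mulrC.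
  by under [X in is_derive _ _ X _]eq_fun do rewrite mulrC.
- exact: integrable_abs_moment.
- by move=> s x _; rewrite normrM ler_piMr// cos_norm_le1.
Qed.


Lemma integrable_xcos t :
  mu.-integrable setT (EFin \o (fun x : R => x * cos (t * x))).
Proof.
apply: (integrable_dominated mu (fun x => `|x|) integrable_abs_moment).
  apply: measurable_funM => //; apply: continuous_measurable_fun.
  exact/smooth_continuous/smooth_cos.
by move=> x; rewrite normrM ler_piMr// cos_norm_le1.
Qed.

Lemma integrable_xsin t :
  mu.-integrable setT (EFin \o (fun x : R => - (x * sin (t * x)))).
Proof.
apply: (integrable_dominated mu (fun x => `|x|) integrable_abs_moment).
  apply: measurable_funN; apply: measurable_funM => //; apply: continuous_measurable_fun.
  exact/smooth_continuous/smooth_sin.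
by move=> x; rewrite normrN normrM ler_piMr// sin_norm_le1.
Qed.

(** Real part of [symbol p t * E[X exp (i t X)] + symbol q t * psi t = 0]. The first two integrals
    are kept in the form in which they are the derivatives of [sin_moment] and [cos_moment], so this
    is half of a linear differential system. *)
Lemma stein_trig_cos p q t : stein_trig p q mu ->
  complex.Re (symbol p t) * (\int[mu]_x (x * cos (t * x)))
  + complex.Im (symbol p t) * (\int[mu]_x (- (x * sin (t * x))))
  + complex.Re (symbol q t) * cos_moment mu t
  - complex.Im (symbol q t) * sin_moment mu t = 0.
Proof.
move=> /(_ t)[+ _] => <-; rewrite -mulNr -Rintegral_lin4; last first.
- exact: integrable_sin.
- exact: integrable_cos.
- exact: integrable_xsin.
- exact: integrable_xcos.
apply: eq_Rintegral => x _.
by rewrite /stein_op !diffop_cos !ReM/=; ring.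
Qed.

Lemma stein_trig_sin p q t : stein_trig p q mu ->
  - complex.Re (symbol p t) * (\int[mu]_x (- (x * sin (t * x))))
  + complex.Im (symbol p t) * (\int[mu]_x (x * cos (t * x)))
  + complex.Re (symbol q t) * sin_moment mu t
  + complex.Im (symbol q t) * cos_moment mu t = 0.
Proof.
move=> /(_ t)[_ +] => <-; rewrite -Rintegral_lin4; last first.
- exact: integrable_cos.
- exact: integrable_sin.
- exact: integrable_xcos.
- exact: integrable_xsin.
apply: eq_Rintegral => x _.
by rewrite /stein_op !diffop_sin !ImM/=; ring.
Qed.

End moment1.

(* The difference [psi] of the two characteristic functions solves
   [psi' = g psi] with [Re g = Im (conj (symbol p) * symbol q) / |symbol p|^2],
   so that [|psi|^2] is monotone on both half-lines, and it vanishes at 0. *)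
Lemma stein_trig_unique p q mu nu :
  mu.-integrable setT (EFin \o (id : R -> R)) ->
  nu.-integrable setT (EFin \o (id : R -> R)) ->
  (forall t, 0 < complex.Re (symbol p t) ^+ 2 + complex.Im (symbol p t) ^+ 2) ->
  (forall t, t * (complex.Re (symbol p t) * complex.Im (symbol q t)
              - complex.Im (symbol p t) * complex.Re (symbol q t)) <= 0) ->
  stein_trig p q mu -> stein_trig p q nu ->
  forall t, cos_moment mu t = cos_moment nu t /\ sin_moment mu t = sin_moment nu t.
Proof.
move=> mu1 nu1 p0 pq smu snu t.
pose U s := cos_moment mu s - cos_moment nu s.
pose V s := sin_moment mu s - sin_moment nu s.
pose dU s : R := \int[mu]_x (- (x * sin (s * x))) - \int[nu]_x (- (x * sin (s * x))).
pose dV s : R := \int[mu]_x (x * cos (s * x)) - \int[nu]_x (x * cos (s * x)).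
have UE (s : R) : is_derive s 1 U (dU s).
  exact: (is_deriveB (is_derive_cos_moment mu1 s) (is_derive_cos_moment nu1 s)).
have VE (s : R) : is_derive s 1 V (dV s).
  exact: (is_deriveB (is_derive_sin_moment mu1 s) (is_derive_sin_moment nu1 s)).
(* [M s] is the squared modulus of [psi (t s)]. Rescaling by [t] treats both half-lines at once on
   the segment from 0 to 1. *)
pose M s := U (t * s) * U (t * s) + V (t * s) * V (t * s).
pose dM s := 2 * t * (U (t * s) * dU (t * s) + V (t * s) * dV (t * s)).
have ME (s : R) : is_derive s 1 M (dM s).
  have tE := is_derive_scale t (is_derive_id s 1).
  have U' := is_derive_comp tE (UE (t * s)); have V' := is_derive_comp tE (VE (t * s)).
  apply: (is_derive_eq (is_derive_add (is_derive_mul U' U') (is_derive_mul V' V'))).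
  by rewrite /dM; ring.
have dM0 s : 0 < s -> dM s <= 0.
  move=> s0; rewrite /dM; set r := t * s.
  have e1 := stein_trig_cos mu1 r smu; have e2 := stein_trig_cos nu1 r snu.
  have e3 := stein_trig_sin mu1 r smu; have e4 := stein_trig_sin nu1 r snu.
  have := pq r; have := p0 r; move: e1 e2 e3 e4.
  set a := complex.Re (symbol p r); set b := complex.Im (symbol p r).
  set c := complex.Re (symbol q r); set e := complex.Im (symbol q r).
  move=> e1 e2 e3 e4 ab0 abce.
  have E1 : a * dV r + b * dU r + c * U r - e * V r = 0.
    rewrite /dV /dU /U /V -[RHS](subrr 0) -{1}e1 -e2; ring.
  have E2 : - a * dU r + b * dV r + c * V r + e * U r = 0.
    rewrite /dV /dU /U /V -[RHS](subrr 0) -{1}e3 -e4; ring.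
  have K : (a ^+ 2 + b ^+ 2) * (U r * dU r + V r * dV r) =
      (a * e - b * c) * (U r ^+ 2 + V r ^+ 2).
    (* The multipliers of the two equations come from taking the real part of [(E1 + i E2)] times
       [i conj(symbol p) conj(psi)]. *)
    have -> : (a ^+ 2 + b ^+ 2) * (U r * dU r + V r * dV r) =
      (a * e - b * c) * (U r ^+ 2 + V r ^+ 2)
      + (a * V r + b * U r) * (a * dV r + b * dU r + c * U r - e * V r)
      + (b * V r - a * U r) * (- a * dU r + b * dV r + c * V r + e * U r) by ring.
    by rewrite E1 E2; ring.
  have K2 : s * (a ^+ 2 + b ^+ 2) * (t * (U r * dU r + V r * dV r)) <= 0.
    have -> : s * (a ^+ 2 + b ^+ 2) * (t * (U r * dU r + V r * dV r)) =
      r * (a * e - b * c) * (U r ^+ 2 + V r ^+ 2) by rewrite -mulrA [X in s * X]mulrCA K /r; ring.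
    by rewrite mulr_le0_ge0// addr_ge0// sqr_ge0.
  by move: K2; rewrite pmulr_rle0 ?mulr_gt0// => K2; rewrite -mulrA pmulr_rle0.
(* The mean value theorem gives [M 1 - M 0 = dM c] with [c > 0], so [M 1 <= 0] once [M 0 = 0]; being
   a sum of squares, [M 1] is zero. *)
have [c c01] := @MVT _ M dM 0 1 ltr01 (fun s _ => ME s)
   (continuous_subspaceT (fun s => is_derive_continuous (ME s))).
have M0 : M 0 = 0.
  have c0 (la : probability R R) : cos_moment la 0 = 1.
    rewrite /cos_moment; under eq_Rintegral do rewrite mul0r cos0.
    exact: Rintegral_prob_cst.
  have s0 (la : probability R R) : sin_moment la 0 = 0.
    rewrite /sin_moment; under eq_Rintegral do rewrite mul0r sin0.
    exact: Rintegral_prob_cst.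
  by rewrite /M mulr0 /U /V !c0 !s0; ring.
have cpos : 0 < c by move: c01; rewrite in_itv/= => /andP[].
rewrite M0 !subr0 mulr1 => M1; have := dM0 _ cpos; rewrite -M1 /M mulr1 => UV0.
have : U t * U t + V t * V t == 0.
  by rewrite eq_le UV0 addr_ge0// -expr2 sqr_ge0.
rewrite paddr_eq0 -?expr2 ?sqr_ge0// !sqrf_eq0 !subr_eq0.
by move=> /andP[/eqP ? /eqP ?].
Qed.

End characteristic_function.

(** * Gaussian cutoff *)

Section gaussian_cutoff.
Context {R : realType}.
Implicit Types (f : R -> R) (p q : {poly R}) (x a : R).

Definition gauss x : R := expR (- (x ^+ 2)).

(** Up to the sign [(-1)^n], the Hermite polynomials attached to the weight [exp (- x^2)]. *)
Fixpoint gauss_poly n : {poly R} :=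
  if n is k.+1 then (gauss_poly k)^`() - 2%:P * 'X * gauss_poly k else 1.

Lemma is_derive_gauss x : is_derive x 1 gauss (- (2 * x) * gauss x).
Proof.
have dsq := is_derive_mul (is_derive_id x 1) (is_derive_id x 1).
have H := is_derive_comp (is_derive_scale (-1) dsq) (is_derive_expR (-1 * (x * x))).
rewrite (_ : gauss = fun y => expR (-1 * (y * y))).
  by apply: (is_derive_eq H); ring.
by apply/funext => y; rewrite /gauss expr2 mulN1r.
Qed.

Lemma derive1n_gauss n : derive1n n gauss = fun x => (gauss_poly n).[x] * gauss x.
Proof.
pose F k x := (gauss_poly k).[x] * gauss x.
have FE k x : is_derive x 1 (F k) (F k.+1 x).
  have H := is_derive_mul (is_derive_poly (gauss_poly k) x) (is_derive_gauss x).
  apply: (is_derive_eq H); rewrite /F/= !(hornerD, hornerN, hornerM, hornerC, hornerX); ring.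
rewrite -[RHS]/(F n) -(derive1n_seq FE); congr derive1n.
by apply/funext => x; rewrite /F/= hornerE mul1r.
Qed.

Lemma smooth_gauss : smooth gauss.
Proof.
move=> n x; rewrite derive1n_gauss.
by case: (is_derive_mul (is_derive_poly (gauss_poly n) x) (is_derive_gauss x)).
Qed.

(** First [|x|^k <= 1 + x^(2k)], since [u <= 1 + u^2]. Then, for [k > 0], [x^(2k) exp (- x^2)] is
    the [k]-th power of [x^2 exp (- x^2 / k) = k y exp (- y)] with [y = x^2 / k], and
    [y exp (- y) <= 1]. *)
Lemma gauss_pow_bound (k : nat) : exists C : R, forall x, `|x ^+ k * gauss x| <= C.
Proof.
exists (1 + k%:R ^+ k) => x.
rewrite normrM normrX [X in _ * X]gtr0_norm ?expR_gt0//.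
have H1 : `|x| ^+ k <= 1 + (x ^+ 2) ^+ k.
  rewrite -(real_normK (num_real x)) -exprM mulnC exprM.
  have : 0 <= (`|x| ^+ k - 1) ^+ 2 by rewrite sqr_ge0.
  have : 0 <= `|x| ^+ k by [].
  by move: (_ ^+ k) => a; nra.
have g0 : 0 <= gauss x by exact: expR_ge0.
apply: (le_trans (ler_wpM2r g0 H1)); rewrite mulrDl mul1r lerD//.
  by rewrite /gauss -[leRHS]expR0 ler_expR oppr_le0 sqr_ge0.
case: k {H1} => [|k]; first by rewrite !expr0 mul1r /gauss -[leRHS]expR0 ler_expR oppr_le0 sqr_ge0.
have -> : gauss x = expR (- (x ^+ 2 / k.+1%:R)) ^+ k.+1.
  rewrite -expRM_natl /gauss; congr expR.
  by rewrite mulrN mulrC divfK// pnatr_eq0.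
rewrite -exprMn; apply: lerXn2r; rewrite ?nnegrE//.
  by apply: mulr_ge0; [exact: sqr_ge0|exact: expR_ge0].
set y := x ^+ 2 / _.
have -> : x ^+ 2 = k.+1%:R * y by rewrite /y mulrC divfK// pnatr_eq0.
rewrite -mulrA ler_piMr// expRN ler_pdivrMr ?expR_gt0// mul1r.
by apply: le_trans (expR_ge1Dx y); rewrite lerDr.
Qed.

Lemma gauss_poly_bound p : exists C : R, forall x, `|p.[x] * gauss x| <= C.
Proof.
have /choice[C HC] := gauss_pow_bound.
exists (\sum_(i < size p) `|p`_i| * C i) => x.
rewrite horner_coef mulr_suml (le_trans (ler_norm_sum _ _ _))//.
by apply: ler_sum => i _; rewrite -mulrA normrM ler_wpM2l.
Qed.

Lemma bounded_derivatives_gauss : bounded_derivatives gauss.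
Proof. by move=> n; rewrite derive1n_gauss; exact: gauss_poly_bound. Qed.

Definition cutoff f a x := f x * gauss (a * x).

Lemma derive1n_cutoff f a n x : smooth f ->
  derive1n n (cutoff f a) x = \sum_(i < n.+1) 'C(n, i)%:R *
    (derive1n i f x * (a ^+ (n - i) * derive1n (n - i) gauss (a * x))).
Proof.
move=> sf; rewrite /cutoff (derive1n_mul n x sf (smooth_scale (c := a) smooth_gauss)).
by apply: eq_bigr => i _; rewrite (derive1n_scale a (n - i) smooth_gauss).
Qed.

Lemma smooth_cutoff f a : smooth f -> smooth (cutoff f a).
Proof. by move=> sf; exact: (smooth_mul sf (smooth_scale (c := a) smooth_gauss)). Qed.

(** In the Leibniz sum the power [x^m] is absorbed by the Gaussian as [a^-m (a x)^m]. The resulting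
    constant may blow up as [a] tends to 0; this is harmless, since Schwartz decay is used for each
    fixed [a] only. *)
Lemma schwartz_cutoff f a : a != 0 -> smooth f -> bounded_derivatives f ->
  schwartz (cutoff f a).
Proof.
move=> a0 sf bf; split; first exact: smooth_cutoff.
move=> m n; have /choice[B HB] := bf.
have /choice[C HC] : forall j, exists C : R, forall x,
    `|x ^+ m * derive1n j gauss x| <= C.
  move=> j; have [C HC] := gauss_poly_bound ('X^m * gauss_poly j).
  by exists C => x; rewrite derive1n_gauss mulrA; have := HC x; rewrite hornerM hornerXn.
exists (\sum_(i < n.+1) 'C(n, i)%:R * (B i * (`|a| ^+ (n - i) * (`|a^-1| ^+ m * C (n - i)%N)))) => x.
rewrite derive1n_cutoff// mulr_sumr (le_trans (ler_norm_sum _ _ _))//.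
apply: ler_sum => i _; rewrite mulrCA normrM normr_nat ler_wpM2l//.
rewrite mulrCA normrM ler_pM// mulrCA normrM normrX ler_wpM2l ?exprn_ge0//.
have -> : x ^+ m = a^-1 ^+ m * (a * x) ^+ m by rewrite -exprMn mulKf.
by rewrite -mulrA normrM normrX ler_wpM2l ?exprn_ge0.
Qed.

(** The uniformity in [a] is what dominated convergence requires. It holds because the chain rule
    only produces nonnegative powers of [a], at most 1 in modulus. *)
Lemma cutoff_bound f n : smooth f -> bounded_derivatives f ->
  exists C : R, forall a x, `|a| <= 1 -> `|derive1n n (cutoff f a) x| <= C.
Proof.
move=> sf bf; have /choice[B HB] := bf.
have /choice[C HC] := bounded_derivatives_gauss.
exists (\sum_(i < n.+1) 'C(n, i)%:R * (B i * C (n - i)%N)) => a x a1.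
rewrite derive1n_cutoff// (le_trans (ler_norm_sum _ _ _))//.
apply: ler_sum => i _; rewrite normrM normr_nat ler_wpM2l// normrM ler_pM//.
rewrite normrM normrX (le_trans _ (HC (n - i)%N (a * x)))// ler_piMl//.
by rewrite exprn_ile1.
Qed.

Lemma cutoff_cvg f n x : smooth f ->
  derive1n n (cutoff f k.+1%:R^-1) x @[k --> \oo] --> derive1n n f x.
Proof.
(* As a function of the cutoff parameter the Leibniz sum is continuous at 0. There every term with
   [i < n] carries a positive power of 0, and the term [i = n] is the derivative of [f]. *)
move=> sf; pose G a := \sum_(i < n.+1) 'C(n, i)%:R *
    (derive1n i f x * (a ^+ (n - i) * derive1n (n - i) gauss (a * x))).
have -> : derive1n n f x = G 0.
  have g0 : gauss 0 = 1 by rewrite /gauss expr0n oppr0 expR0.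
  rewrite /G big_ord_recr/= subnn binn derive1n0 expr0 !mul0r g0 !mul1r mulr1.
  rewrite big1 ?add0r// => i _.
  by rewrite expr0n subn_eq0 leqNgt ltn_ord/= mul0r !mulr0.
have cG : {for 0, continuous G}.
  apply: cvg_big => [|i _]; first exact: add_continuous.
  do 2 (apply: cvgM; first exact: cvg_cst).
  apply: cvgM; first exact: exprn_continuous.
  have cg := smooth_continuous (smooth_derive1n (m := (n - i)%N) smooth_gauss).
  have cm : continuous (fun a : R => a * x).
    by move=> a; apply: cvgM; [exact: cvg_id|exact: cvg_cst].
  exact: (continuous_fun_comp cg cm).
rewrite (_ : (fun k => _) = G \o (fun k => k.+1%:R^-1)).
  by apply: (cvg_comp _ _ (@cvg_harmonic R)).
by apply/funext => k; rewrite /= derive1n_cutoff.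
Qed.

End gaussian_cutoff.

Section cutoff_stein.
Context {R : realType} (mu : probability R R).
Hypothesis mu1 : mu.-integrable setT (EFin \o (id : R -> R)).
Implicit Types (p q : {poly R}) (f : R -> R).

Lemma diffop_cvg p (f_ : nat -> R -> R) f x :
  (forall n, derive1n n (f_ k) x @[k --> \oo] --> derive1n n f x) ->
  diffop p (f_ k) x @[k --> \oo] --> diffop p f x.
Proof.
move=> ff; rewrite /diffop; apply: cvg_big => [|i _]; first exact: add_continuous.
by apply: cvgM; [exact: cvg_cst|exact: ff].
Qed.

(** The constants are chosen before [f]: they depend only on the bounds [B], so one dominating
    function serves a whole sequence of cutoffs. Its linear growth matches the first moment
    assumption. *)
Lemma stein_op_linear_growth p q (B : nat -> R) :
  exists C : R * R, forall f, (forall n x, `|derive1n n f x| <= B n) ->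
  forall x, `|stein_op p q f x| <= C.2 + C.1 * `|x|.
Proof.
pose S p := \sum_(l < size p) `|p`_l| * B l.
exists (S p, S q) => f HB x.
have dS r : `|diffop r f x| <= S r.
  rewrite (le_trans (ler_norm_sum _ _ _))//; apply: ler_sum => l _.
  by rewrite normrM ler_wpM2l.
rewrite /stein_op addrC (le_trans (ler_normD _ _))// lerD//=.
by rewrite normrM mulrC ler_wpM2r.
Qed.

Lemma continuous_stein_op p q f : smooth f -> continuous (stein_op p q f).
Proof.
move=> sf x; have cr (r : {poly R}) : {for x, continuous (diffop r f)}.
  by apply: smooth_continuous; exact: smooth_diffop.
have cid : {for x, continuous (@idfun R)} by exact: cvg_id.
exact: (continuousD (continuousM cid (cr p)) (cr q)).
Qed.

Lemma integrable_growth (a b : R) :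
  mu.-integrable setT (EFin \o (fun x : R => a + b * `|x|)).
Proof.
apply: integrable_add; first exact: finite_measure_integrable_cst.
by apply: integrable_scale; exact: integrable_abs_moment.
Qed.

Lemma stein_schwartz_bounded p q :
  (forall f, schwartz f -> \int[mu]_x stein_op p q f x = 0) ->
  forall f, smooth f -> bounded_derivatives f -> \int[mu]_x stein_op p q f x = 0.
Proof.
move=> H f sf bf.
have /choice[B HB] : forall n, exists C : R, forall a x, `|a| <= 1 ->
    `|derive1n n (cutoff f a) x| <= C by move=> n; exact: cutoff_bound.
have [C HC] := stein_op_linear_growth p q B.
pose e k : R := k.+1%:R^-1.
have e1 k : `|e k| <= 1.
  by rewrite ger0_norm ?invr_ge0// invf_le1// ler1n.
have L : \int[mu]_x stein_op p q (cutoff f (e k)) x @[k --> \oo] -->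
    \int[mu]_x stein_op p q f x.
  apply: (cvg_Rintegral mu (stein_op p q f) (fun x => C.2 + C.1 * `|x|)).
  - by move=> n; apply: continuous_measurable_fun; apply: continuous_stein_op; exact: smooth_cutoff.
  - by apply: continuous_measurable_fun; exact: continuous_stein_op.
  - exact: integrable_growth.
  - by move=> n x; apply: HC => k y; exact: HB.
  - move=> x.
    have Lr (r : {poly R}) :
        diffop r (cutoff f (e k)) x @[k --> \oo] --> diffop r f x.
      by apply: (@diffop_cvg r (fun k => cutoff f (e k))) => n; exact: cutoff_cvg.
    have Lx : (fun=> x : R) k @[k --> \oo] --> x by exact: cvg_cst.
    exact: (cvgD (cvgM Lx (Lr p)) (Lr q)).
have L0 : \int[mu]_x stein_op p q (cutoff f (e k)) x @[k --> \oo] --> (0 : R).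
  rewrite (_ : (fun k => _) = cst 0); first exact: cvg_cst.
  apply/funext => k; apply: H; apply: schwartz_cutoff => //.
  by rewrite invr_eq0 pnatr_eq0.
exact: (cvg_unique _ L L0).
Qed.

End cutoff_stein.

(** * Characteristic functions determine laws on the real line *)

Section characteristic_function_unique.
Context {R : realType}.

Lemma cvg_dist_le (f a : nat -> R) (l : R) :
  (forall n, `|f n - l| <= a n) -> a n @[n --> \oo] --> 0 -> f n @[n --> \oo] --> l.
Proof.
move=> fa /cvgrPdist_lt a0; apply/cvgrPdist_lt => e /a0; apply: filterS => n.
rewrite sub0r normrN distrC => an; apply: le_lt_trans (fa n) _.
exact: le_lt_trans (ler_norm _) an.
Qed.

Lemma continuous_dilation (k c : R) : continuous (fun x : R => k * (x - c)).
Proof.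
move=> x; apply: cvgM; first exact: cvg_cst.
by apply: cvgB; [exact: cvg_id|exact: cvg_cst].
Qed.

Variables mu nu : probability R R.
Hypothesis cos_eq : forall t, cos_moment mu t = cos_moment nu t.
Hypothesis sin_eq : forall t, sin_moment mu t = sin_moment nu t.

Let same (f : R -> R) := \int[mu]_x f x = \int[nu]_x f x.

(** The limit is only required to be measurable because the last limit taken, from arctangents to a
    step function, leaves the continuous functions. *)
Let same_lim (f_ : nat -> R -> R) (f : R -> R) (c : R) :
  (forall n, continuous (f_ n)) -> measurable_fun setT f ->
  (forall n x, `|f_ n x| <= c) -> (forall x, f_ n x @[n --> \oo] --> f x) ->
  (forall n, same (f_ n)) -> same f.
Proof.
move=> cf mf fc ff sf; have mfn n := continuous_measurable_fun (cf n).
have intc (la : probability R R) : la.-integrable setT (EFin \o cst c).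
  exact: finite_measure_integrable_cst.
have mu_cvg := cvg_Rintegral mu f (cst c) mfn mf (intc mu) fc ff.
have nu_cvg := cvg_Rintegral nu f (cst c) mfn mf (intc nu) fc ff.
apply: (@cvg_unique _ _ (\int[mu]_x f_ n x @[n --> \oo])) => //.
by rewrite (funext sf : (fun n => \int[mu]_x f_ n x) = fun n => \int[nu]_x f_ n x).
Qed.

Let cos_shift (la : probability R R) (s c : R) :
  \int[la]_x cos (s * (x - c)) =
  cos (s * c) * cos_moment la s + sin (s * c) * sin_moment la s.
Proof.
rewrite /cos_moment /sin_moment.
rewrite -(RintegralZl _ measurableT (integrable_cos la s)).
rewrite -(RintegralZl _ measurableT (integrable_sin la s)).
rewrite -RintegralD//; last 2 first.
- by apply: integrable_scale; exact: integrable_cos.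
- by apply: integrable_scale; exact: integrable_sin.
by apply: eq_Rintegral => x _; rewrite mulrBr cosB; ring.
Qed.

Let same_cos_shift (s c : R) : same (fun x => cos (s * (x - c))).
Proof. by rewrite /same !cos_shift cos_eq sin_eq. Qed.

(* [laplace T u] is the integral of [expR (- s) * cos (s * u)] over [0, T]. *)
Let laplace (T u : R) :=
  (1 + expR (- T) * (u * sin (T * u) - cos (T * u))) / (1 + u ^+ 2).

Let laplace_den (u : R) : 0 < 1 + u ^+ 2.
Proof. by rewrite ltr_pwDl// sqr_ge0. Qed.

Let laplace_num (T u : R) : `|u * sin (T * u) - cos (T * u)| / (1 + u ^+ 2) <= 2.
Proof.
rewrite ler_pdivrMr//; apply: (@le_trans _ _ (`|u| + 1)).
  rewrite (le_trans (ler_normB _ _))// lerD ?cos_norm_le1// normrM ler_piMr//.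
  exact: sin_norm_le1.
have : 0 <= (`|u| - 1) ^+ 2 by rewrite sqr_ge0.
have : 0 <= `|u| ^+ 2 by rewrite sqr_ge0.
rewrite -(real_normK (num_real u)); nra.
Qed.

Let laplace_dist (T u : R) :
  `|laplace T u - (1 + u ^+ 2)^-1| <= expR (- T) * 2.
Proof.
rewrite /laplace mulrDl mul1r addrAC subrr add0r -mulrA normrM ger0_norm ?expR_ge0//.
rewrite ler_wpM2l ?expR_ge0// normrM [X in _ * X]gtr0_norm ?invr_gt0//.
Qed.

Let cauchy_le1 (u : R) : `|(1 + u ^+ 2)^-1| <= 1.
Proof.
by rewrite gtr0_norm ?invr_gt0// invf_le1// lerDl sqr_ge0.
Qed.

Let laplace_bound (T u : R) : `|laplace T u| <= 1 + expR (- T) * 2.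
Proof.
rewrite -[laplace T u](subrK (1 + u ^+ 2)^-1) addrC.
by rewrite (le_trans (ler_normD _ _))// lerD.
Qed.

Let is_derive_laplace (T u : R) :
  is_derive T 1 (laplace ^~ u) (expR (- T) * cos (T * u)).
Proof.
have dexp : is_derive T 1 (fun t : R => expR (- t)) (- expR (- T)).
  have := is_derive_comp (is_derive_scale (-1) (is_derive_id T 1))
    (is_derive_expR (-1 * T)).
  rewrite !mulN1r mulrN1.
  by under [X in is_derive _ _ X _]eq_fun do rewrite mulN1r.
have ds := is_derive_sintx u T; have dc := is_derive_costx u T.
have H := is_derive_scale (1 + u ^+ 2)^-1 (is_derive_add (is_derive_cst (1 : R) T 1)
  (is_derive_mul dexp (is_derive_add (is_derive_scale u ds) (is_derive_scale (-1) dc)))).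
rewrite (_ : (laplace ^~ u) = fun y => (1 + u ^+ 2)^-1 * (1 + expR (- y) *
    (u * sin (u * y) + -1 * cos (u * y)))); last first.
  apply/funext => y; rewrite /laplace mulrC mulN1r.
  by rewrite [y * u]mulrC.
apply: (is_derive_eq H); rewrite [T * u]mulrC.
by field; rewrite gt_eqF.
Qed.

Let continuous_laplace T : continuous (laplace T).
Proof.
move=> u; apply: cvgM; last first.
  apply: cvgV; first by rewrite gt_eqF.
  by apply: cvgD; [exact: cvg_cst|exact: exprn_continuous].
apply: cvgD; first exact: cvg_cst.
apply: cvgM; first exact: cvg_cst.
apply: cvgB; last exact: (is_derive_continuous (is_derive_costx T u)).
by apply: cvgM; [exact: cvg_id|exact: (is_derive_continuous (is_derive_sintx T u))].
Qed.

(** The derivative in [T] of either side is [expR (- T)] times the expectation of a shifted cosine,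
    the same for [mu] and [nu]; both sides vanish at [T = 0]. This stands in for an exchange of
    integrals. *)
Let same_laplace (T k c : R) : same (fun x => laplace T (k * (x - c))).
Proof.
have cont S : continuous (fun x => laplace S (k * (x - c))).
  exact: (continuous_fun_comp (@continuous_laplace S) (@continuous_dilation k c)).
pose g (la : probability R R) S : R := \int[la]_x laplace S (k * (x - c)).
have dg (la : probability R R) (S : R) : is_derive S 1 (g la)
    (\int[la]_x (expR (- S) * cos (S * (k * (x - c))))).
  (* On the window [|t - S| < 1] the kernel is at most [expR (- t) <= expR (1 - S)]. *)
  apply: (is_derive_Rintegral la (fun t x => expR (- t) * cos (t * (k * (x - c))))
    (cst (expR (1 - S)))).
  - by move=> t; apply: (@continuous_bounded_integrable _ la _ _ (cont t)) => x; exact: laplace_bound.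
  - by move=> t x; exact: is_derive_laplace.
  - exact: finite_measure_integrable_cst.
  - move=> t x /ltr_normlP[ta tb]; rewrite normrM ger0_norm ?expR_ge0//.
    rewrite (@le_trans _ _ (expR (- t)))//; first by rewrite ler_piMr ?expR_ge0// cos_norm_le1.
    rewrite ler_expR; lra.
have dgE (la : probability R R) (S : R) :
    \int[la]_x (expR (- S) * cos (S * (k * (x - c)))) =
    expR (- S) * \int[la]_x cos ((S * k) * (x - c)).
  rewrite -RintegralZl//; first by apply: eq_Rintegral => x _; rewrite mulrA.
  apply: (@continuous_bounded_integrable _ la _ 1) => [|x]; last exact: cos_norm_le1.
  exact: (continuous_fun_comp (@continuous_cos R) (@continuous_dilation (S * k) c)).
have dg0 (S : R) : is_derive S 1 (fun S => g mu S - g nu S) 0.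
  apply: (is_derive_eq (is_deriveB (dg mu S) (dg nu S))).
  by rewrite !dgE same_cos_shift subrr.
have g0 (la : probability R R) : g la 0 = 0.
  rewrite /g /laplace; under eq_Rintegral do
    rewrite !mul0r sin0 cos0 oppr0 expR0 mulr0 sub0r mulrN1 subrr mul0r.
  by rewrite Rintegral_prob_cst.
have := is_derive_0_is_cst T 0 dg0.
by rewrite !g0 subrr => /eqP; rewrite subr_eq0 => /eqP.
Qed.

Let continuous_cauchy (k c : R) : continuous (fun x => (1 + (k * (x - c)) ^+ 2)^-1).
Proof.
move=> x; apply: cvgV; first by rewrite gt_eqF.
apply: cvgD; first exact: cvg_cst.
exact: (continuous_fun_comp (@exprn_continuous R 2) (@continuous_dilation k c)).
Qed.

Let same_cauchy (k c : R) : same (fun x => (1 + (k * (x - c)) ^+ 2)^-1).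
Proof.
(* The bound 3 is [1 + 2 expR (- n)] at its largest, for [n = 0]. *)
apply: (@same_lim (fun n x => laplace n%:R (k * (x - c))) _ 3) => [n| |n x|x|n].
- exact: (continuous_fun_comp (@continuous_laplace _) (@continuous_dilation k c)).
- by apply: continuous_measurable_fun; exact: continuous_cauchy.
- rewrite (le_trans (laplace_bound _ _))//.
  have : expR (- n%:R) <= 1 :> R by rewrite -[leRHS]expR0 ler_expR oppr_le0.
  lra.
- apply: (cvg_dist_le (a := fun n => expR (- n%:R) * 2)) => [n|]; first exact: laplace_dist.
  by rewrite -[X in _ --> X](mul0r 2); apply: cvgM; [exact: cvgn_expR|exact: cvg_cst].
- exact: same_laplace.
Qed.


Let continuous_atan_dil (k c : R) : continuous (fun x : R => atan (k * (x - c))).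
Proof. exact: (continuous_fun_comp (@continuous_atan R) (@continuous_dilation k c)). Qed.

Let atan_bound (u : R) : `|atan u| <= pi / 2.
Proof. by rewrite ler_norml ltW ?atan_gtNpi2// ltW// atan_ltpi2. Qed.

(** The derivative in the centre is a multiple of a Cauchy kernel, so the difference of the two
    expectations does not depend on the centre. Sending the centre to minus infinity makes both
    expectations tend to [pi / 2], so that difference is zero. *)
Let same_atan (k c : R) : 0 < k -> same (fun x => atan (k * (x - c))).
Proof.
move=> k0; pose g (la : probability R R) b : R := \int[la]_x atan (k * (x - b)).
have dg (la : probability R R) (b : R) : is_derive b 1 (g la)
    (\int[la]_x (- k * (1 + (k * (x - b)) ^+ 2)^-1)).
  apply: (is_derive_Rintegral la (fun b x => - k * (1 + (k * (x - b)) ^+ 2)^-1) (cst k)).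
  - move=> t; apply: (@continuous_bounded_integrable _ la _ _ (@continuous_atan_dil k t)) => x.
    exact: atan_bound.
  - move=> t x.
    have := is_derive_comp (is_derive_affine (- k) (k * x) t)
      (is_derive1_atan (- k * t + k * x)).
    rewrite (_ : (fun y => _) = fun y => atan (k * (x - y))); last first.
      by apply/funext => y; congr atan; ring.
    by move=> H; apply: (is_derive_eq H); rewrite mulrC; congr (_ * (1 + _ ^+ 2)^-1); ring.
  - exact: finite_measure_integrable_cst.
  - move=> t x _; rewrite /= normrM normrN (gtr0_norm k0) ler_piMr ?cauchy_le1//.
    exact: ltW.
have dg0 (b : R) : is_derive b 1 (fun b => g mu b - g nu b) 0.
  apply: (is_derive_eq (is_deriveB (dg mu b) (dg nu b))).
  have i (la : probability R R) : la.-integrable setT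
      (EFin \o (fun x : R => (1 + (k * (x - b)) ^+ 2)^-1)).
    apply: (@continuous_bounded_integrable _ la _ 1 (@continuous_cauchy k b)) => x.
    exact: cauchy_le1.
  rewrite (RintegralZl _ measurableT (i mu)) (RintegralZl _ measurableT (i nu)).
  by rewrite same_cauchy subrr.
have gcst b : g mu b - g nu b = g mu c - g nu c.
  exact: (is_derive_0_is_cst b c dg0).
have glim (la : probability R R) : g la (- n%:R) @[n --> \oo] --> \int[la]_(x in setT) (pi / 2 : R).
  apply: (cvg_Rintegral la (cst (pi / 2)) (cst (pi / 2))) => [n|||n x|x].
  - by apply: continuous_measurable_fun; exact: continuous_atan_dil.
  - exact: measurable_cst.
  - exact: finite_measure_integrable_cst.
  - exact: atan_bound.
  - apply: (@cvg_comp _ _ _ (fun n => k * (x - - n%:R)) (@atan R) _ +oo); last exact: cvgy_atan.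
    apply/cvgryPge => M; near=> n; rewrite opprK mulrC -ler_pdivrMr// -lerBlDl.
    by near: n; exact: nbhs_infty_ger.
have gc : g mu (- n%:R) - g nu (- n%:R) @[n --> \oo] --> (0 : R).
  rewrite -[X in _ --> X](subrr (\int[mu]_(x in setT) (pi / 2 : R))).
  apply: cvgB; first exact: glim.
  rewrite (_ : \int[mu]_(x in setT) (pi / 2 : R) = \int[nu]_(x in setT) (pi / 2)).
    exact: glim.
  by rewrite !Rintegral_prob_cst.
have gc' : g mu (- n%:R) - g nu (- n%:R) @[n --> \oo] --> g mu c - g nu c.
  by rewrite (funext (fun n : nat => gcst (- n%:R))); exact: cvg_cst.
by apply/eqP; rewrite -subr_eq0; apply/eqP; exact: (cvg_unique _ gc' gc).
Unshelve. all: by end_near.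
Qed.

Let step (c x : R) : R := if c < x then pi / 2 else - (pi / 2).

Let stepE c x : step c x = pi * \1_`]c, +oo[ x - pi / 2.
Proof.
rewrite /step indicE; have [cx|cx] := ltP c x.
  by rewrite mem_set/= ?in_itv/= ?cx//; field.
by rewrite memNset/= ?in_itv/= ?ltNge ?cx// mulr0 sub0r.
Qed.

Let same_step c : same (step c).
Proof.
(* Because of the shift by the inverse of [n.+1], the limit at [x = c] is
   [- (pi / 2)]. *)
apply: (@same_lim (fun n x => atan (n.+1%:R ^+ 2 * (x - (c + n.+1%:R^-1)))) _ (pi / 2)).
- by move=> n; exact: continuous_atan_dil.
- rewrite (funext (stepE c)); apply: measurable_funB => //.
  by apply: measurable_funM => //; exact: measurable_indic.
- by move=> n x; exact: atan_bound.
- move=> x.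
  (* The dilation is the inverse square of the shift, so that it wins over the shift: at [x = c] the
     argument is [- n.+1]. For [x > c] it is at least [n.+1] as soon as [n.+1 * (x - c) >= 2]. *)
  have E n : n.+1%:R ^+ 2 * (x - (c + n.+1%:R^-1)) = n.+1%:R * (n.+1%:R * (x - c) - 1) :> R.
    have : n.+1%:R != 0 :> R by rewrite pnatr_eq0.
    by move: n.+1%:R => a a0; field.
  rewrite /step; case: ltP => cx.
    apply: (@cvg_comp _ _ _ (fun n => n.+1%:R ^+ 2 * (x - (c + n.+1%:R^-1))) (@atan R) _ +oo); last exact: cvgy_atan.
    apply: (@ger_cvgy _ _ _ _ (fun n => n%:R)); last exact: cvgr_idn.
    near=> n; rewrite E.
    have H : 2 / (x - c) <= n%:R by near: n; exact: nbhs_infty_ger.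
    have H2 : 2 <= n.+1%:R * (x - c).
      rewrite -ler_pdivrMr ?subr_gt0//; apply: (le_trans H); by rewrite ler_nat.
    have : n%:R <= n.+1%:R :> R by rewrite ler_nat.
    have : 0 <= n.+1%:R :> R by [].
    nra.
  pose v n : R := n.+1%:R ^+ 2 * (x - (c + n.+1%:R^-1)).
  have vy : - v n @[n --> \oo] --> +oo.
    apply: (@ger_cvgy _ _ _ _ (fun n => n%:R)); last exact: cvgr_idn.
    near=> n; rewrite /v E.
    have : n%:R <= n.+1%:R :> R by rewrite ler_nat.
    have : n.+1%:R * (n.+1%:R * (x - c)) <= 0.
      by do 2 rewrite mulr_ge0_le0//; rewrite subr_le0.
    lra.
  have vpi : atan (- v n) @[n --> \oo] --> pi / 2.
    exact: (@cvg_comp _ _ _ (fun n => - v n) (@atan R) _ +oo _ vy (@cvgy_atan R)).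
  rewrite (_ : (fun n => _) = (fun n => - atan (- v n))); first exact: cvgN.
  by apply/funext => n; rewrite atanN opprK.
- by move=> n; apply: same_atan; rewrite exprn_gt0.
Unshelve. all: by end_near.
Qed.

Let same_ray c : mu `]c, +oo[%classic = nu `]c, +oo[%classic.
Proof.
have E (la : probability R R) :
    \int[la]_x step c x = pi * fine (la `]c, +oo[%classic) - pi / 2.
  have i : la.-integrable setT (EFin \o (fun x : R => \1_`]c, +oo[ x : R)).
    apply: (integrable_dominated la (cst 1)).
    - exact: finite_measure_integrable_cst.
    - exact: measurable_indic.
    - by move=> x; rewrite indicE; case: (_ \in _); rewrite ?normr1 ?normr0.
  under eq_Rintegral do rewrite stepE.
  rewrite RintegralB//; last 2 first.
  - exact: integrable_scale.
  - exact: finite_measure_integrable_cst.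
  rewrite RintegralZl// Rintegral_prob_cst.
  by rewrite /Rintegral integral_indic// setIT.
have pi0 : (pi : R) != 0 by rewrite gt_eqF// pi_gt0.
have := same_step c; rewrite /same !E => /addIr /(mulfI pi0) H.
have fin (la : probability R R) : la `]c, +oo[%classic \is a fin_num.
  exact: fin_num_measure.
by rewrite -(fineK (fin mu)) -(fineK (fin nu)) H.
Qed.

(** Open right rays are stable under intersection, generate the Borel sets, and exhaust the line
    along []- n, +oo[], so agreement on them is enough. *)
Lemma characteristic_function_unique (A : set R) : measurable A -> mu A = nu A.
Proof.
move=> mA.
apply: (@measure_unique _ R R (@RGenOInfty.G R) (fun n => `]- n%:R, +oo[%classic) _ _ _ _ mu nu) => //.
- exact: RGenOInfty.measurableE.
- move=> _ _ [x ->] [y ->]; exists (Num.max x y).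
  apply/seteqP; split => z /=; rewrite !in_itv/= !andbT gt_max.
    by move=> [-> ->].
  by move/andP.
- by move=> n; exists (- n%:R).
- apply/seteqP; split => // x _; exists (Num.truncn `|x|).+1 => //=.
  rewrite in_itv/= andbT ltrNl (le_lt_trans _ (truncnS_gt _))//.
  by rewrite -normrN ler_norm.
- by move=> _ [x ->]; exact: same_ray.
- by move=> k; rewrite (le_lt_trans (probability_le1 _ _)) ?ltry.
Qed.

End characteristic_function_unique.

(** * Gaussian integration by parts *)

Section normal_integration.
Context {R : realType}.
Notation leb := (@lebesgue_measure R).
Notation nrm := (@normal_prob R 0 1).
Notation pdf := (@normal_pdf R 0 1).

(** The Radon-Nikodym derivative of the normal law is determined only almost everywhere; it agrees
    there with the density because both have the same integral over every measurable set. *)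
Lemma ge0_integral_normal_prob (f : R -> R) : measurable_fun setT f ->
  (forall x, 0 <= f x) ->
  (\int[nrm]_x (f x)%:E = \int[leb]_x (f x * pdf x)%:E)%E.
Proof.
move=> mf f0; have dom := normal_prob_dominates (0 : R) 1.
rewrite -(Radon_Nikodym_SigmaFinite.change_of_variables dom)//; last exact/measurable_EFinP.
have mpdf : measurable_fun setT (fun x => (pdf x)%:E).
  by apply/measurable_EFinP; exact: measurable_normal_pdf.
have irn := Radon_Nikodym_SigmaFinite.f_integrable dom.
apply: ae_eq_integral => //.
- by apply: emeasurable_funM; [exact/measurable_EFinP|exact: (measurable_int _ irn)].
- by apply/measurable_EFinP; apply: measurable_funM => //; exact: measurable_normal_pdf.
under [X in ae_eq _ _ _ X]eq_fun do rewrite EFinM.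
apply: ae_eqe_mul2l; apply: integral_ae_eq => //.
by move=> E _ mE; rewrite -Radon_Nikodym_SigmaFinite.f_integral.
Qed.

Lemma integrable_normal_prob (f : R -> R) : measurable_fun setT f ->
  leb.-integrable setT (EFin \o (fun x => f x * pdf x)) ->
  nrm.-integrable setT (EFin \o f).
Proof.
move=> mf /integrableP[_ fpdf]; apply/integrableP; split; first exact/measurable_EFinP.
suff : (\int[nrm]_x (`|f x|)%:E < +oo)%E by [].
rewrite ge0_integral_normal_prob//; last exact: measurableT_comp.
apply: le_lt_trans fpdf; rewrite le_eqVlt; apply/orP; left; apply/eqP.
by apply: eq_integral => x _; rewrite /= normrM [`|pdf x|]ger0_norm ?normal_pdf_ge0.
Qed.

Lemma Rintegral_normal_prob (f : R -> R) : measurable_fun setT f ->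
  leb.-integrable setT (EFin \o (fun x => f x * pdf x)) ->
  \int[nrm]_x f x = \int[leb]_x (f x * pdf x).
Proof.
move=> mf ifp; have mnf : measurable_fun setT (fun x => `|f x|) by exact: measurableT_comp.
have inf : leb.-integrable setT (EFin \o (fun x => `|f x| * pdf x)).
  apply: (integrable_dominated leb (fun x => `|f x * pdf x|)).
  - exact: (integrable_abse ifp).
  - by apply: measurable_funM => //; exact: measurable_normal_pdf.
  - by move=> x; rewrite !normrM normr_id.
have E (g : R -> R) : measurable_fun setT g -> (forall x, 0 <= g x) ->
    \int[nrm]_x g x = \int[leb]_x (g x * pdf x).
  by move=> mg g0; rewrite /Rintegral ge0_integral_normal_prob.
have ig := integrable_normal_prob mf ifp; have ing := integrable_normal_prob mnf inf.
(* Writing [f] as a difference of nonnegative functions reduces to the previous case. *)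
have -> : \int[nrm]_x f x = \int[nrm]_x (`|f x| + f x) - \int[nrm]_x `|f x|.
  by rewrite RintegralD// addrAC subrr add0r.
rewrite !E//; first last.
- by move=> x; rewrite -lerBlDr sub0r -normrN ler_norm.
- exact: measurable_funD.
under eq_Rintegral do rewrite mulrDl.
by rewrite RintegralD// addrAC subrr add0r.
Qed.

Let pdfE x : pdf x = normal_peak 1 * expR (- (x ^+ 2 / 2)).
Proof.
by rewrite normal_pdfE// /normal_fun subr0 expr1n mulNr.
Qed.

Let peak_ge0 : 0 <= normal_peak (1 : R). Proof. exact: normal_peak_ge0. Qed.

(** With [y = x^2 / 4], [x^2 exp (- x^2 / 2) = 4 y exp (- 2 y) <= 4 exp (- y)], and
    [exp (- x^2 / 4)] is the unnormalized Gaussian of variance 2. This yields both the second moment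
    and the decay of boundary terms. *)
Let pdf_sq_bound x : x ^+ 2 * pdf x <= normal_peak 1 * 4 * normal_fun 0 (Num.sqrt 2) x.
Proof.
rewrite pdfE mulrCA -mulrA ler_wpM2l//.
rewrite /normal_fun subr0 sqr_sqrtr//.
set y := x ^+ 2 / 4.
have -> : x ^+ 2 = 4 * y by rewrite /y mulrC divfK.
have -> : 4 * y / 2 = y + y by field.
have -> : - (4 * y) / (2 *+ 2) = - y by rewrite -mulr_natr; field.
rewrite opprD expRD -mulrA ler_wpM2l// mulrA ler_piMl ?expR_ge0//.
rewrite expRN ler_pdivrMr ?expR_gt0// mul1r.
by apply: le_trans (expR_ge1Dx y); rewrite lerDr.
Qed.

Let integrable_normal_fun2 :
  leb.-integrable setT (EFin \o (normal_fun 0 (Num.sqrt 2) : R -> R)).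
Proof.
have s0 : Num.sqrt 2 != 0 :> R by rewrite gt_eqF// sqrtr_gt0.
have := @integrable_scale _ _ _ leb (normal_peak (Num.sqrt 2))^-1 _ (integrable_normal_pdf 0 (Num.sqrt 2)).
rewrite (_ : (EFin \o _) = EFin \o (normal_fun 0 (Num.sqrt 2)))//.
apply/funext => x /=; rewrite normal_pdfE// mulKf// gt_eqF// normal_peak_gt0//.
Qed.

Let sq_pdf_ge0 x : 0 <= x ^+ 2 * pdf x.
Proof. by apply: mulr_ge0; [exact: sqr_ge0|exact: normal_pdf_ge0]. Qed.

Lemma integrable_sq_normal_pdf :
  leb.-integrable setT (EFin \o (fun x => x ^+ 2 * pdf x)).
Proof.
apply: (integrable_dominated leb (fun x => normal_peak 1 * 4 * normal_fun 0 (Num.sqrt 2) x)).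
- exact: integrable_scale.
- apply: measurable_funM; last exact: measurable_normal_pdf.
  exact: (continuous_measurable_fun (@exprn_continuous R 2)).
- by move=> x; rewrite ger0_norm ?sq_pdf_ge0.
Qed.

Lemma integrable_quadratic_normal_pdf (f : R -> R) (a b : R) :
  measurable_fun setT f -> (forall x, `|f x| <= a + b * x ^+ 2) ->
  leb.-integrable setT (EFin \o (fun x => f x * pdf x)).
Proof.
move=> mf fab; apply: (integrable_dominated leb (fun x => a * pdf x + b * (x ^+ 2 * pdf x))).
- apply: integrable_add; apply: integrable_scale; last exact: integrable_sq_normal_pdf.
  exact: integrable_normal_pdf.
- by apply: measurable_funM => //; exact: measurable_normal_pdf.
- move=> x; rewrite normrM [X in _ * X]ger0_norm ?normal_pdf_ge0//.
  by rewrite mulrA -mulrDl ler_wpM2r ?normal_pdf_ge0.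
Qed.

Lemma integrable_quadratic_normal (f : R -> R) (a b : R) :
  measurable_fun setT f -> (forall x, `|f x| <= a + b * x ^+ 2) ->
  nrm.-integrable setT (EFin \o f).
Proof.
move=> mf fab; apply: integrable_normal_prob => //.
exact: integrable_quadratic_normal_pdf fab.
Qed.

Lemma is_derive_normal_pdf (x : R) : is_derive x 1 pdf (- x * pdf x).
Proof.
have dsq := is_derive_mul (is_derive_id x 1) (is_derive_id x 1).
have H := is_derive_scale (normal_peak 1) (is_derive_comp (is_derive_scale (- 2^-1) dsq)
  (is_derive_expR (- 2^-1 * (x * x)))).
rewrite (_ : pdf = fun y => normal_peak 1 * expR (- 2^-1 * (y * y))).
  by apply: (is_derive_eq H); field.
by apply/funext => y; rewrite pdfE; congr (_ * expR _); field.
Qed.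

(** The decay hypothesis bounds the boundary terms at [n.+1] and [- n.+1] by [C / n.+1] each, whence
    the rate [2 C / n.+1]. *)
Lemma Rintegral_derivative_eq0 (u du : R -> R) (C : R) :
  (forall x : R, is_derive x 1 u (du x)) -> continuous du ->
  leb.-integrable setT (EFin \o du) ->
  (forall x, `|x * u x| <= C) ->
  \int[leb]_x du x = 0.
Proof.
move=> duE cdu idu uC.
pose I n : set R := `[- n.+1%:R, n.+1%:R]%classic.
have FTC n : \int[leb]_(x in I n) du x = u n.+1%:R - u (- n.+1%:R).
  have nn : - n.+1%:R < n.+1%:R :> R by rewrite gtrN// ltr0n.
  rewrite /Rintegral (@continuous_FTC2 _ du u)//.
  - exact: continuous_subspaceT.
  - split; first by move=> x _; case: (duE x).
      by apply: cvg_at_right_filter; exact: (is_derive_continuous (duE _)).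
    by apply: cvg_at_left_filter; exact: (is_derive_continuous (duE _)).
  - by move=> x _; apply: is_derive_derive1.
have L : \int[leb]_(x in I n) du x @[n --> \oo] --> \int[leb]_x du x.
  have mdu : measurable_fun setT du by exact: continuous_measurable_fun.
  under eq_fun do rewrite Rintegral_mkcond.
  apply: (cvg_Rintegral leb du (fun x => `|du x|)).
  - move=> n; have mI : measurable (I n) by exact: measurable_itv.
    exact: ((measurable_restrictT du mI).1 (measurable_funTS mdu)).
  - exact: mdu.
  - exact: (integrable_abse idu).
  - by move=> n x; rewrite patchE; case: ifP => // _; rewrite normr0.
  - move=> x; apply: cvg_near_cst; near=> n; rewrite patchE mem_set//.
    have : `|x| <= n%:R by near: n; exact: nbhs_infty_ger.
    rewrite ler_norml /I/= in_itv/= => /andP[h1 h2].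
    have : n%:R <= n.+1%:R :> R by rewrite ler_nat.
    by move=> h3; apply/andP; split; lra.
have L0 : \int[leb]_(x in I n) du x @[n --> \oo] --> (0 : R).
  apply: (cvg_dist_le (a := fun n => 2 * C * n.+1%:R^-1)) => [n|].
    have n0 : 0 < n.+1%:R :> R by rewrite ltr0n.
    have ua := uC n.+1%:R; have ub := uC (- n.+1%:R).
    rewrite normrM (gtr0_norm n0) in ua.
    rewrite normrM normrN (gtr0_norm n0) in ub.
    rewrite subr0 FTC ler_pdivlMr// mulrC.
    apply: (le_trans (ler_wpM2l (ltW n0) (ler_normB _ _))).
    by rewrite mulrDr mulr_natl mulr2n lerD.
  by rewrite -[X in _ --> X](mulr0 (2 * C)); apply: cvgM; [exact: cvg_cst|exact: cvg_harmonic].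
exact: (cvg_unique _ L L0).
Unshelve. all: by end_near.
Qed.

Lemma quadratic_bound (l a b x y z : R) : `|y| <= a -> `|z| <= b ->
  `|(x ^+ 2 - 1) * y - 2 * l * (x ^+ 2 * z)| <= a + (a + 2 * `|l| * b) * x ^+ 2.
Proof.
move=> ya zb.
have -> : a + (a + 2 * `|l| * b) * x ^+ 2 = (x ^+ 2 + 1) * a + 2 * `|l| * (x ^+ 2 * b).
  by ring.
have nsq : `|x ^+ 2| = x ^+ 2 by rewrite ger0_norm ?sqr_ge0.
rewrite (le_trans (ler_normB _ _))// lerD//.
  by rewrite normrM ler_pM// (le_trans (ler_normB _ _))// normr1 nsq.
have nl : `|2 * l| = 2 * `|l| by rewrite normrM ger0_norm.
rewrite normrM nl [X in _ * X]normrM nsq ler_wpM2l ?mulr_ge0//.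
by rewrite ler_wpM2l ?sqr_ge0.
Qed.

Lemma normal_integration_by_parts (f f' : R -> R) (a b l c : R) :
  (forall x : R, is_derive x 1 f (f' x)) -> continuous f' ->
  (forall x, `|f x| <= a) -> (forall x, `|f' x| <= b) ->
  \int[nrm]_x ((x ^+ 2 - 1) * f (l * (x ^+ 2 - 1) + c)
              - 2 * l * (x ^+ 2 * f' (l * (x ^+ 2 - 1) + c))) = 0.
Proof.
move=> df cf' fa f'b.
pose g x : R := l * (x ^+ 2 - 1) + c.
pose k x := (x ^+ 2 - 1) * f (g x) - 2 * l * (x ^+ 2 * f' (g x)).
have gE (x : R) : is_derive x 1 g (2 * l * x).
  have H := is_derive_add (is_derive_scale l (is_derive_add
    (is_derive_mul (is_derive_id x 1) (is_derive_id x 1)) (is_derive_cst (-1 : R) x 1)))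
    (is_derive_cst c x 1).
  rewrite (_ : g = fun y => l * (y * y + -1) + c).
    by apply: (is_derive_eq H); ring.
  by apply/funext => y; rewrite /g expr2.
have cg : continuous g by move=> x; exact: (is_derive_continuous (gE x)).
have cf : continuous f by move=> x; exact: (is_derive_continuous (df x)).
have cfg := continuous_fun_comp cf cg.
have cf'g := continuous_fun_comp cf' cg.
have csq : continuous (fun x : R => x ^+ 2) by exact: (@exprn_continuous R 2).
have ck : continuous k.
  move=> x; have c1 : (fun=> 1 : R) y @[y --> x] --> (1 : R) by exact: cvg_cst.
  have c2 : (fun=> 2 * l : R) y @[y --> x] --> 2 * l by exact: cvg_cst.
  exact: (cvgB (cvgM (cvgB (csq x) c1) (cfg x)) (cvgM c2 (cvgM (csq x) (cf'g x)))).
have mk : measurable_fun setT k by exact: continuous_measurable_fun.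
have kb x : `|k x| <= a + (a + 2 * `|l| * b) * x ^+ 2 by exact: quadratic_bound.
have ikp := integrable_quadratic_normal_pdf mk kb.
rewrite Rintegral_normal_prob//.
pose u x := - (x * (f (g x) * pdf x)).
have uE (x : R) : is_derive x 1 u (k x * pdf x).
  have H := is_derive_scale (-1) (is_derive_mul (is_derive_id x 1)
    (is_derive_mul (is_derive_comp (gE x) (df (g x))) (is_derive_normal_pdf x))).
  rewrite (_ : u = fun y => -1 * (y * (f (g y) * pdf y))).
    by apply: (is_derive_eq H); rewrite /k; ring.
  by apply/funext => y; rewrite mulN1r.
have cpdf : continuous pdf by move=> x; exact: (is_derive_continuous (is_derive_normal_pdf x)).
apply: (Rintegral_derivative_eq0 uE (C := a * (normal_peak 1 * 4))) => //.
- by move=> x; exact: (continuousM (ck x) (cpdf x)).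
- move=> x; rewrite /u mulrN normrN mulrA -expr2 mulrCA normrM ler_pM//.
  rewrite ger0_norm ?sq_pdf_ge0//.
  apply: le_trans (pdf_sq_bound x) _; rewrite ler_piMr ?mulr_ge0//.
  by rewrite /normal_fun -[leRHS]expR0 ler_expR mulNr oppr_le0 divr_ge0 ?sqr_ge0.
Qed.

End normal_integration.

(** * Quadratic forms in independent normal variables *)

Section independence.
Context {R : realType} {d : measure_display} {Omega : measurableType d}
  (P : probability Omega R) {I : finType} (N : I -> {RV P >-> R}).
Hypothesis Nind : mutually_independent N.
Variable i : I.

(** A pi-system of events depending on the variables [N j], [j != i], only; each of these variables
    is measurable for the sigma-algebra that it generates. *)
Let cylinders : set (set Omega) := [set C | exists A : I -> set R,
  (forall j, measurable (A j)) /\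
  C = \bigcap_(j in [set` [set~ i]%SET]) (N j @^-1` A j)].

Let cylinders_setI : setI_closed cylinders.
Proof.
move=> _ _ [A [mA ->]] [B [mB ->]]; exists (fun j => A j `&` B j); split.
  by move=> j; exact: measurableI.
by rewrite -bigcapI; apply: eq_bigcapr => j _; rewrite preimage_setI.
Qed.

Let measurable_preim j (A : set R) : measurable A -> measurable (N j @^-1` A).
Proof. by move=> mA; exact: measurable_funPTI. Qed.

Let cylinders_measurable : cylinders `<=` measurable.
Proof.
move=> _ [A [mA ->]]; apply: fin_bigcap_measurable => [|j _]; first exact: finite_finpred.
exact: measurable_preim.
Qed.

Let cylinders_setT : cylinders setT.
Proof.
exists (fun=> setT); split => //.
by apply/seteqP; split.
Qed.

Let independent_cylinders (B : set R) (C : set Omega) : measurable B -> cylinders C ->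
  P (N i @^-1` B `&` C) = (P (N i @^-1` B) * P C)%E.
Proof.
move=> mB [A [mA ->]].
(* Mutual independence is used twice: on all indices with [A'], and on the indices other than [i]
   with [A]. The two products differ by the factor of [i]. *)
pose A' j := if j == i then B else A j.
have mA' j : measurable (A' j) by rewrite /A'; case: ifP.
have := Nind [set: I]%SET mA'.
rewrite (bigD1 i) ?inE//= {2}/A' eqxx.
under eq_bigr => j /andP[_ ji] do rewrite /A' (negbTE ji).
move=> H; have := Nind [set~ i]%SET mA.
under eq_bigl do rewrite !inE.
move=> H2; rewrite H2.
have -> : (\prod_(j | j != i) P (N j @^-1` A j) =
   \prod_(j in [set: I]%SET | j != i) P (N j @^-1` A j))%E.
  by apply: eq_bigl => j; rewrite inE.
rewrite -H; congr (P _); apply/seteqP; split => w.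
  move=> [Bw Aw] j _ /=; rewrite /A'; case: eqP => [->//|/eqP ji].
  by apply: Aw; rewrite /= !inE.
move=> Aw; split; first by have := Aw i; rewrite /A' eqxx; apply; rewrite /= inE.
move=> j /=; rewrite !inE => ji; have := Aw j; rewrite /A' (negbTE ji); apply.
by rewrite /= inE.
Qed.

(** As functions of [C], both sides are finite measures: [P] restricted to an event, and [P] scaled
    by the probability of that event. They agree on the pi-system, hence on what it generates. *)
Let independent_sigma (B : set R) (C : set Omega) : measurable B -> <<s cylinders >> C ->
  P (N i @^-1` B `&` C) = (P (N i @^-1` B) * P C)%E.
Proof.
move=> mB sC; have mNB := measurable_preim i mB.
have r0 : 0 <= fine (P (N i @^-1` B)) by exact: fine_ge0.
have rE : (fine (P (N i @^-1` B)))%:E = P (N i @^-1` B).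
  by rewrite fineK// fin_num_measure.
pose m1 : {measure set Omega -> \bar R} := mrestr P mNB.
pose m2 : {measure set Omega -> \bar R} := mscale (NngNum r0) P.
have m1E X : m1 X = P (N i @^-1` B `&` X) by rewrite /m1/= /mrestr setIC.
have m2E X : m2 X = (P (N i @^-1` B) * P X)%E by rewrite /m2/= /mscale/= rE.
rewrite -m1E -m2E.
apply: (g_sigma_algebra_measure_unique cylinders cylinders_measurable
  (fun=> setT)) => //.
- by apply/seteqP; split => // x _; exists 0%N.
- by move=> A cA; rewrite m1E m2E; exact: independent_cylinders.
- by move=> _; rewrite m1E setIT (le_lt_trans (probability_le1 _ _)) ?ltry.
Qed.

Let sigma_measurable (j : I) : j != i ->
  @measurable_fun _ _ (g_sigma_algebraType cylinders) R setT (N j).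
Proof.
move=> ji _ B mB; rewrite setTI; apply: sub_sigma_algebra.
exists (fun k => if k == j then B else setT); split.
  by move=> k; case: ifP.
apply/seteqP; split => w.
  by move=> Bw k _ /=; case: eqP => [->|].
by move=> /(_ j); rewrite /= eqxx; apply; rewrite !inE.
Qed.

Variables (g : I -> R -> R).
Hypothesis mg : forall j, measurable_fun setT (g j).

Let W w : R := \sum_(j | j != i) g j (N j w).

Lemma independent_sum (A B : set R) : measurable A -> measurable B ->
  P (N i @^-1` A `&` W @^-1` B) = (P (N i @^-1` A) * P (W @^-1` B))%E.
Proof.
move=> mA mB; apply: independent_sigma => //.
have mW : @measurable_fun _ _ (g_sigma_algebraType cylinders) R setT W.
  rewrite (_ : W = fun w => \sum_j (if j != i then g j (N j w) else 0)); last first.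
    by apply/funext => w; rewrite /W big_mkcond.
  apply: measurable_sum => j; case: (boolP (j != i)) => ji; last exact: measurable_cst.
  by apply: measurableT_comp => //; exact: sigma_measurable.
suff : <<s cylinders >> (setT `&` W @^-1` B) by rewrite setTI.
exact: (mW measurableT B mB).
Qed.

Let measurable_W : measurable_fun setT W.
Proof.
rewrite (_ : W = fun w => \sum_j (if j != i then g j (N j w) else 0)); last first.
  by apply/funext => w; rewrite /W big_mkcond.
apply: measurable_sum => j; case: (boolP (j != i)) => ji; last exact: measurable_cst.
exact: measurableT_comp.
Qed.

Let joint w : R * R := (N i w, W w).

Let measurable_joint : measurable_fun setT joint.
Proof. exact: measurable_fun_pair. Qed.

HB.instance Definition _ := @isMeasurableFun.Build _ _ _ _ W measurable_W.
HB.instance Definition _ := @isMeasurableFun.Build _ _ _ _ joint measurable_joint.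

Lemma joint_product (X : set (R * R)) : measurable X ->
  (distribution P (N i) \x distribution P W)%E X = distribution P joint X.
Proof.
apply: product_measure_unique => A B mA mB.
exact: independent_sum.
Qed.

(** By independence the pair has a product law, and Fubini integrates over [N i] first, with [W]
    frozen at [y]. Integrability for the product is carried over from [P] through the law of the
    pair. *)
Lemma Rintegral_joint_eq0 (k : R * R -> R) : measurable_fun setT k ->
  P.-integrable setT (EFin \o (fun w => k (N i w, W w))) ->
  (forall y, (\int[distribution P (N i)]_x (k (x, y))%:E = 0)%E) ->
  \int[P]_w k (N i w, W w) = 0.
Proof.
move=> mk ik k0.
pose m1 := distribution P (N i); pose m2 := distribution P W.
have mk' : measurable_fun setT (EFin \o k) by exact/measurable_EFinP.
have ij : (distribution P joint).-integrable setT (EFin \o k).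
  by apply: integrable_pushforward => //; rewrite preimage_setT.
have im : (m1 \x m2)%E.-integrable setT (EFin \o k).
  move/integrableP : ij => [_ ij]; apply/integrableP; split => //.
  apply: le_lt_trans ij; rewrite le_eqVlt; apply/orP; left; apply/eqP.
  by apply: eq_measure_integral => A mA _; exact: joint_product.
have -> : \int[P]_w k (N i w, W w) = fine (\int[m1 \x m2]_z (k z)%:E)%E.
  congr fine.
  transitivity (\int[distribution P joint]_z (k z)%:E)%E.
    by rewrite integral_pushforward// preimage_setT.
  by apply: eq_measure_integral => A mA _; apply/esym; exact: joint_product.
rewrite -(integral21_prod_meas1 im) integral0_eq// => y _.
exact: k0.
Qed.

End independence.

Section standard_normal_variable.
Context {R : realType} {d : measure_display} {Omega : measurableType d}
  (P : probability Omega R).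
Notation nrm := (@normal_prob R 0 1).

(* [normal_prob] lives on [measurableTypeR R], which has the same measurable
   sets as [R] but another display. *)
Let idTR : measurableTypeR R -> R := idfun.

#[local] HB.instance Definition _ :=
  @isMeasurableFun.Build _ _ _ _ idTR (@measurable_id _ _ setT).

Lemma integral_standard_normal (X : {RV P >-> R}) (f : R -> R) :
  standard_normal X -> measurable_fun setT f -> nrm.-integrable setT (EFin \o f) ->
  (\int[distribution P X]_x (f x)%:E = \int[nrm]_x (f x)%:E)%E.
Proof.
move=> hX mf intf; have mf' : measurable_fun setT (EFin \o f) by exact/measurable_EFinP.
transitivity (\int[distribution nrm idTR]_x (f x)%:E)%E.
  by apply: eq_measure_integral => A mA _; exact: hX.
by rewrite integral_distribution.
Qed.

Lemma integrable_standard_normal (X : {RV P >-> R}) (f : R -> R) :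
  standard_normal X -> measurable_fun setT f -> nrm.-integrable setT (EFin \o f) ->
  P.-integrable setT (EFin \o (fun w => f (X w))).
Proof.
move=> hX mf intf.
have mnf : measurable_fun setT (fun x => `|f x|) by exact: measurableT_comp.
apply/integrableP; split.
  by apply/measurable_EFinP; exact: (measurableT_comp mf (measurable_funPT X)).
have intnf : nrm.-integrable setT (EFin \o (fun x => `|f x|)) by exact: (integrable_abse intf).
have := integral_standard_normal hX mnf intnf.
rewrite ge0_integral_distribution//; last exact/measurable_EFinP.
move=> E; apply: (@le_lt_trans _ _ (\int[nrm]_x (`|f x|)%:E)%E); first by rewrite -E.
by case/integrableP : intf.
Qed.

End standard_normal_variable.

Section gaussian_quadratic_form.
Context {R : realType} {d : measure_display} {Omega : measurableType d}
  (P : probability Omega R) {I : finType} (N : I -> {RV P >-> R}).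
Hypothesis hN : forall i, standard_normal (N i).
Hypothesis Nind : mutually_independent N.
Variable lam : I -> R.

(** Weights are attached to coordinates and not to blocks, because integration by parts acts on one
    variable at a time. *)
Definition quadratic_form (w : Omega) : R := \sum_i lam i * ((N i w) ^+ 2 - 1).
Local Notation F := quadratic_form.

Let measurable_sq : measurable_fun setT (fun x : R => x ^+ 2).
Proof. exact: (continuous_measurable_fun (@exprn_continuous R 2)). Qed.

Let measurable_N i : measurable_fun setT (N i).
Proof. exact: measurable_funPT. Qed.

Let measurable_N2 i : measurable_fun setT (fun w => (N i w) ^+ 2 : R).
Proof. exact: (measurableT_comp measurable_sq (measurable_N i)). Qed.

Lemma integrable_sq_normal_rv i : P.-integrable setT (EFin \o (fun w => (N i w) ^+ 2)).
Proof.
apply: (integrable_standard_normal (hN i) (f := fun x => x ^+ 2)) => //.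
apply: (@integrable_quadratic_normal _ _ 0 1) => // x.
by rewrite add0r mul1r ger0_norm ?sqr_ge0.
Qed.

Lemma measurable_quadratic_form : measurable_fun setT F.
Proof.
apply: measurable_sum => i; apply: measurable_funM => //.
exact: measurable_funB.
Qed.

Lemma integrable_quadratic_form : P.-integrable setT (EFin \o F).
Proof.
rewrite (_ : EFin \o F = fun w => \sum_i (lam i * ((N i w) ^+ 2 - 1))%:E)%E; last first.
  by apply/funext => w; rewrite /= /quadratic_form sumEFin.
apply: integrable_sum => // i _; apply: integrable_scale.
apply: (@integrable_add _ _ _ _ _ (cst (-1))); first exact: integrable_sq_normal_rv.
exact: finite_measure_integrable_cst.
Qed.

Lemma integrable_sq_bounded i (f : R -> R) (a : R) : continuous f ->
  (forall x, `|f x| <= a) ->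
  P.-integrable setT (EFin \o (fun w => (N i w) ^+ 2 * f (F w))).
Proof.
move=> cf fa; apply: (integrable_dominated P (fun w => a * (N i w) ^+ 2)).
- by apply: integrable_scale; exact: integrable_sq_normal_rv.
- apply: measurable_funM => //; apply: measurableT_comp => //.
    exact: continuous_measurable_fun.
  exact: measurable_quadratic_form.
- by move=> w; rewrite normrM ger0_norm ?sqr_ge0// mulrC ler_wpM2r ?sqr_ge0.
Qed.

Lemma integrable_bounded_form (f : R -> R) (a : R) : continuous f ->
  (forall x, `|f x| <= a) -> P.-integrable setT (EFin \o (fun w => f (F w))).
Proof.
move=> cf fa; apply: (integrable_dominated P (cst a)) => //.
- exact: finite_measure_integrable_cst.
- apply: measurableT_comp; first exact: continuous_measurable_fun.
  exact: measurable_quadratic_form.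
Qed.

Lemma quadratic_form_by_parts i (f f' : R -> R) (a b : R) :
  (forall x : R, is_derive x 1 f (f' x)) -> continuous f' ->
  (forall x, `|f x| <= a) -> (forall x, `|f' x| <= b) ->
  \int[P]_w (((N i w) ^+ 2 - 1) * f (F w)
             - 2 * lam i * ((N i w) ^+ 2 * f' (F w))) = 0.
Proof.
move=> df cf' fa f'b.
have cf : continuous f by move=> x; exact: (is_derive_continuous (df x)).
have mf := continuous_measurable_fun cf; have mf' := continuous_measurable_fun cf'.
pose g j (x : R) := lam j * (x ^+ 2 - 1).
have mg j : measurable_fun setT (g j).
  by apply: measurable_funM => //; exact: measurable_funB.
(* [z.1] stands for [N i] and [z.2] for the sum over the other indices, which is independent of
   it. *)
pose k (z : R * R) := (z.1 ^+ 2 - 1) * f (lam i * (z.1 ^+ 2 - 1) + z.2)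
   - 2 * lam i * (z.1 ^+ 2 * f' (lam i * (z.1 ^+ 2 - 1) + z.2)).
have m1 : measurable_fun setT (fun z : R * R => z.1 ^+ 2).
  exact: (measurableT_comp measurable_sq measurable_fst).
have m11 : measurable_fun setT (fun z : R * R => z.1 ^+ 2 - 1) by exact: measurable_funB.
have m2 : measurable_fun setT (fun z : R * R => lam i * (z.1 ^+ 2 - 1) + z.2).
  by apply: measurable_funD => //; exact: measurable_funM.
have mk : measurable_fun setT k.
  apply: measurable_funB; first by apply: measurable_funM => //; exact: measurableT_comp.
  do 2 (apply: measurable_funM => //); exact: measurableT_comp.
have FE w : F w = lam i * ((N i w) ^+ 2 - 1) + \sum_(j | j != i) g j (N j w).
  by rewrite /quadratic_form (bigD1 i).
have E w : k (N i w, \sum_(j | j != i) g j (N j w)) =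
    ((N i w) ^+ 2 - 1) * f (F w) - 2 * lam i * ((N i w) ^+ 2 * f' (F w)).
  by rewrite FE.
under eq_Rintegral do rewrite -E.
have ik : P.-integrable setT (EFin \o (fun w => k (N i w, \sum_(j | j != i) g j (N j w)))).
  rewrite (funext E : (fun w => _) = _).
  have i1 := integrable_sq_bounded i cf fa; have i2 := integrable_sq_bounded i cf' f'b.
  have i3 := integrable_bounded_form cf fa.
  rewrite (_ : (fun w => _) = fun w => ((N i w) ^+ 2 * f (F w) + -1 * f (F w))
      + (- (2 * lam i)) * ((N i w) ^+ 2 * f' (F w))); last by apply/funext => w; ring.
  by apply: integrable_add; [apply: integrable_add|]; rewrite //; exact: integrable_scale.
apply: (Rintegral_joint_eq0 Nind mg mk ik) => y.
have ky : measurable_fun setT (fun x => k (x, y)).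
  exact: (measurableT_comp mk (pair2_measurable y)).
have iky : (normal_prob (0 : R) 1).-integrable setT (EFin \o (fun x => k (x, y))).
  apply: (@integrable_quadratic_normal _ _ a (a + 2 * `|lam i| * b)) => // x.
  exact: quadratic_bound.
rewrite (integral_standard_normal (hN i) ky iky) -[LHS]fineK; last first.
  exact: (integrable_fin_num _ iky).
by congr EFin; exact: (normal_integration_by_parts (lam i) y df cf' fa f'b).
Qed.


Lemma integrable_centered i (f : R -> R) (a : R) : continuous f ->
  (forall x, `|f x| <= a) ->
  P.-integrable setT (EFin \o (fun w => ((N i w) ^+ 2 - 1) * f (F w))).
Proof.
move=> cf fa.
rewrite (_ : (fun w => _) = fun w => (N i w) ^+ 2 * f (F w) + -1 * f (F w)).
  apply: integrable_add; first exact: integrable_sq_bounded cf fa.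
  by apply: integrable_scale; exact: integrable_bounded_form cf fa.
by apply/funext => w; ring.
Qed.

(** In the integration by parts, [N_i^2 f'] is split as [(N_i^2 - 1) f' + f']; the first piece joins
    the left side and the second remains. *)
Lemma centered_square_resolvent i (f f' : R -> R) (a b : R) :
  (forall x : R, is_derive x 1 f (f' x)) -> continuous f' ->
  (forall x, `|f x| <= a) -> (forall x, `|f' x| <= b) ->
  \int[P]_w (((N i w) ^+ 2 - 1) * (f (F w) - 2 * lam i * f' (F w))) =
  2 * lam i * \int[P]_w f' (F w).
Proof.
move=> df cf' fa f'b.
have cf : continuous f by move=> x; exact: (is_derive_continuous (df x)).
have i1 := integrable_centered i cf fa; have i2 := integrable_centered i cf' f'b.
have i3 := integrable_bounded_form cf' f'b; have i4 := integrable_sq_bounded i cf' f'b.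
rewrite -RintegralZl// -[RHS]add0r -(quadratic_form_by_parts i df cf' fa f'b).
rewrite -RintegralD//; last 2 first.
- have -> : (fun w => ((N i w) ^+ 2 - 1) * f (F w) - 2 * lam i * ((N i w) ^+ 2 * f' (F w)))
    = fun w => ((N i w) ^+ 2 - 1) * f (F w) + - (2 * lam i) * ((N i w) ^+ 2 * f' (F w)).
    by apply/funext => w; ring.
  by apply: integrable_add => //; exact: integrable_scale.
- exact: integrable_scale.
by apply: eq_Rintegral => w _; ring.
Qed.

(** Applying the resolvent identity to [pi_ i (D) phi] puts the same function [p(D) phi] on the left
    for every [i], so the weighted sum rebuilds [F] in front of it. Only a cofactor for each
    coordinate is asked, hence coordinates of equal weight can share a factor of [p]. *)
Lemma stein_quadratic_form (p : {poly R}) (pi_ : I -> {poly R}) (phi : R -> R) :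
  (forall i, p = (1 - (2 * lam i) *: 'X) * pi_ i) ->
  smooth phi -> bounded_derivatives phi ->
  \int[P]_w stein_op p (- \sum_i (2 * lam i ^+ 2) *: ('X * pi_ i)) phi (F w) = 0.
Proof.
move=> pE sphi bphi.
pose f i := diffop (pi_ i) phi; pose f' i := derive1n 1 (f i).
have sf i : smooth (f i) by exact: smooth_diffop.
have bf i : bounded_derivatives (f i) by exact: bounded_diffop.
have df i (x : R) : is_derive x 1 (f i) (f' i x) by exact: (smooth_is_derive 0 x (sf i)).
have cf' i : continuous (f' i) by apply: smooth_continuous; exact: smooth_derive1n.
have pphi i x : diffop p phi x = f i x - 2 * lam i * f' i x.
  by rewrite (pE i) mulrBl mul1r -scalerAl diffopB diffopZ diffopMX.
have key i : \int[P]_w (((N i w) ^+ 2 - 1) * diffop p phi (F w)) =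
    2 * lam i * \int[P]_w f' i (F w).
  have [a Ha] := bf i 0%N; have [b Hb] := bf i 1%N.
  rewrite -(centered_square_resolvent i (df i) (cf' i) Ha Hb).
  by apply: eq_Rintegral => w _; rewrite (pphi i).
have cp : continuous (diffop p phi) by apply: smooth_continuous; exact: smooth_diffop.
have [c Hc] := bounded_diffop p sphi bphi 0%N.
have ic i : P.-integrable setT (EFin \o (fun w => ((N i w) ^+ 2 - 1) * diffop p phi (F w))).
  exact: integrable_centered cp Hc.
have if' i : P.-integrable setT (EFin \o (fun w => f' i (F w))).
  by have [b Hb] := bf i 1%N; exact: integrable_bounded_form (cf' i) Hb.
have -> : \int[P]_w stein_op p (- \sum_i (2 * lam i ^+ 2) *: ('X * pi_ i)) phi (F w) =
   \int[P]_w (\sum_i (lam i * (((N i w) ^+ 2 - 1) * diffop p phi (F w))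
       + (- (2 * lam i ^+ 2)) * f' i (F w))).
  apply: eq_Rintegral => w _.
  rewrite /stein_op big_split/= /quadratic_form mulr_suml; congr (_ + _).
    by apply: eq_bigr => i _; rewrite mulrA.
  rewrite -scaleN1r diffopZ diffop_sum mulr_sumr; apply: eq_bigr => i _.
  by rewrite diffopZ diffopMX// mulN1r mulNr.
rewrite Rintegral_sum; last first.
  by move=> i; apply: integrable_add; exact: integrable_scale.
apply: big1 => i _; rewrite RintegralD//; last 2 first.
- exact: integrable_scale.
- exact: integrable_scale.
by rewrite !RintegralZl// key; ring.
Qed.

End gaussian_quadratic_form.

(** * Blocks of coordinates with a common weight *)

Section blocks.
Local Open Scope nat_scope.
Variables (d q : nat) (m : 'I_d -> nat).

(** Kept convertible to the range condition in the sum that defines [F] in the theorem. Indices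
    start at 0, so blocks are half-open intervals. *)
Definition in_block (k : 'I_d) (i : 'I_q) : bool :=
  \sum_(j < d | (j < k)) m j <= i < \sum_(j < d | (j <= k)) m j.

Lemma in_block_inj (k k' : 'I_d) (i : 'I_q) : in_block k i -> in_block k' i -> k = k'.
Proof.
have H (a b : 'I_d) : a < b -> in_block a i -> in_block b i -> False.
  move=> ab /andP[_ ia] /andP[ib _].
  have : \sum_(j < d | j <= a) m j <= \sum_(j < d | j < b) m j.
    rewrite [leqLHS]big_mkcond [leqRHS]big_mkcond; apply: leq_sum => j _.
    by case: (leqP j a) => // ja; rewrite (leq_ltn_trans ja ab).
  by rewrite leqNgt (leq_ltn_trans ib ia).
move=> ki k'i; apply/val_inj; case: (ltngtP k k') => // kk'.
  by case: (H _ _ kk' ki k'i).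
by case: (H _ _ kk' k'i ki).
Qed.

(** The total being [q] keeps the upper end of the interval within [q], so no index of the block is
    cut off by the type of [i]. *)
Lemma card_block (k : 'I_d) : \sum_(k < d) m k = q -> #|in_block k| = m k.
Proof.
move=> mq; set a := \sum_(j < d | j < k) m j.
have Eb : \sum_(j < d | j <= k) m j = a + m k.
  rewrite (bigD1 k)//= addnC; congr (_ + _); apply: eq_bigl => j.
  by rewrite [RHS]ltn_neqAle andbC.
have aq : a + m k <= q.
  by rewrite -Eb -mq [leqRHS](bigID (fun j : 'I_d => j <= k))/= leq_addr.
rewrite -sum1_card /in_block Eb -/a.
rewrite -(big_mkord (fun i => a <= i < a + m k) (fun=> 1)).
rewrite -[RHS](addKn a) -[RHS]muln1 -sum_nat_const_nat.
rewrite (big_nat_widen _ _ _ _ _ aq) (big_nat_widenl _ _ _ _ _ (leq0n a)).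
by apply: eq_bigl => i; rewrite andTb andbC.
Qed.

(** The option avoids a proof that blocks cover all indices: an index without block will receive
    weight 0 and contribute nothing. *)
Definition block_of (i : 'I_q) : option 'I_d := [pick k | in_block k i].

Lemma sum_block_of (V : nmodType) (h : 'I_d -> 'I_q -> V) :
  (\sum_(i < q) (if block_of i is Some k then h k i else 0) =
   \sum_(k < d) \sum_(i < q | in_block k i) h k i)%R.
Proof.
under [RHS]eq_bigr do rewrite big_mkcond.
rewrite exchange_big; apply: eq_bigr => i _; rewrite -big_mkcond/= /block_of.
case: pickP => [k ki|no].
  rewrite (big_pred1 k)// => k'; apply/idP/eqP => [k'i|->//].
  exact: in_block_inj k'i ki.
by rewrite big_pred0.
Qed.

End blocks.

(** * Symmetric functions and the Stein operator *)

Section elementary_symmetric_coefficients.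
Context {R : realType}.
Implicit Types (c : R).

(** The generating function of the elementary symmetric polynomials: in the expanded product, the
    set [A] of factors that contribute their ['X] term gives degree [#|A|]. *)
Lemma coef_prod_elem_sym n (x : 'I_n -> R) c l :
  (\prod_(j < n) (1 + (c * x j) *: 'X))`_l = c ^+ l * elem_sym x l.
Proof.
under eq_bigr do rewrite addrC.
rewrite bigA_distr coef_sum elem_symE mulr_sumr [RHS]big_mkcond/=.
apply: eq_bigr => A _; rewrite -big_mkcond/= scaler_prod prodr_const coefZ coefXn.
rewrite big_split prodr_const/= eq_sym.
by case: eqP => [->|_]; rewrite ?mulr1// mulr0.
Qed.

Lemma elem_sym0 n (x : 'I_n -> R) : elem_sym x 0 = 1.
Proof.
rewrite elem_symE (big_pred1 finset.set0) ?big_set0// => A.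
by rewrite /= cards_eq0.
Qed.

Lemma elem_sym_full n (x : 'I_n -> R) : elem_sym x n = \prod_(j < n) x j.
Proof.
rewrite elem_symE (big_pred1 [set: _]%SET) => [|A].
  by apply: eq_bigl => j; rewrite inE.
rewrite /= -[X in _ == X]card_ord -cardsT.
by apply/eqP/eqP => [AT|->//]; apply/eqP; rewrite eqEcard finset.subsetT AT leqnn.
Qed.

(** For the shortened tuple [del_coord lambda k] and [l = d] this explains the separate shape of the
    term of order [d] in the equation. *)
Lemma elem_sym_gt n (x : 'I_n -> R) l : (n < l)%N -> elem_sym x l = 0.
Proof.
move=> nl; rewrite elem_symE big_pred0// => A; apply/negbTE.
by rewrite neq_ltn (leq_ltn_trans _ nl)// -[X in (_ <= X)%N]card_ord max_card.
Qed.

(* The Stein equation is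
   [E (Y * diffop (stein_poly1 lambda) phi Y + diffop (stein_poly0 m lambda) phi Y) = 0]. *)
Definition stein_poly1 d (lambda : 'I_d -> R) : {poly R} :=
  \prod_(j < d) (1 - (2 * lambda j) *: 'X).

Definition stein_poly1_del d (lambda : 'I_d -> R) (k : 'I_d) : {poly R} :=
  \prod_(j < d | j != k) (1 - (2 * lambda j) *: 'X).

Lemma stein_poly1E d (lambda : 'I_d -> R) k :
  stein_poly1 lambda = (1 - (2 * lambda k) *: 'X) * stein_poly1_del lambda k.
Proof. by rewrite /stein_poly1 (bigD1 k). Qed.

Lemma coef_stein_poly1 d (lambda : 'I_d -> R) l :
  (stein_poly1 lambda)`_l = (-2) ^+ l * elem_sym lambda l.
Proof.
rewrite -coef_prod_elem_sym /stein_poly1; congr (polyseq _)`_l; apply: eq_bigr => j _.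
by rewrite mulNr scaleNr.
Qed.

Lemma coef_stein_poly1_del d (lambda : 'I_d -> R) k l :
  (stein_poly1_del lambda k)`_l = (-2) ^+ l * elem_sym (del_coord lambda k) l.
Proof.
rewrite -coef_prod_elem_sym; congr (polyseq _)`_l.
transitivity (\prod_(j < d.-1) (1 - (2 * lambda (lift k j)) *: 'X)); last first.
  by apply: eq_bigr => j _; rewrite mulNr scaleNr.
rewrite /stein_poly1_del big_mkcond (@bigD1_ord _ _ _ _ k)//= eqxx mul1r.
by apply: eq_bigr => j _; rewrite eq_sym neq_lift.
Qed.

Definition stein_poly0 d (m : 'I_d -> nat) (lambda : 'I_d -> R) : {poly R} :=
  \sum_(k < d) (lambda k * (m k)%:R) *: (stein_poly1 lambda - stein_poly1_del lambda k).

(** Since [p - p_k = - 2 lambda_k X p_k]. The multiple [*+ m k] prepares the rewriting as a sum over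
    the coordinates of block [k]. *)
Lemma stein_poly0E d (m : 'I_d -> nat) (lambda : 'I_d -> R) :
  stein_poly0 m lambda =
  - \sum_(k < d) (2 * lambda k ^+ 2) *: ('X * stein_poly1_del lambda k) *+ m k.
Proof.
rewrite /stein_poly0 -sumrN; apply: eq_bigr => k _.
rewrite (stein_poly1E lambda k) mulrBl mul1r addrAC subrr add0r -scalerAl.
by rewrite scalerN scalerA -scaler_nat scalerA; congr (- (_ *: _)); ring.
Qed.

Lemma coef_stein_poly0 d (m : 'I_d -> nat) (lambda : 'I_d -> R) l :
  (stein_poly0 m lambda)`_l = (-2) ^+ l * \sum_(k < d) lambda k * (m k)%:R *
    (elem_sym lambda l - elem_sym (del_coord lambda k) l).
Proof.
rewrite coef_sum mulr_sumr; apply: eq_bigr => k _.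
by rewrite coefZ coefB coef_stein_poly1 coef_stein_poly1_del; ring.
Qed.

Lemma size_stein_poly1 d (lambda : 'I_d -> R) : (size (stein_poly1 lambda) <= d.+1)%N.
Proof.
by apply/leq_sizeP => l dl; rewrite coef_stein_poly1 elem_sym_gt ?mulr0.
Qed.

Lemma size_stein_poly0 d (m : 'I_d -> nat) (lambda : 'I_d -> R) :
  (size (stein_poly0 m lambda) <= d.+1)%N.
Proof.
apply/leq_sizeP => l dl; rewrite coef_stein_poly0 big1 ?mulr0// => k _.
rewrite !elem_sym_gt ?subrr ?mulr0//.
by rewrite (leq_ltn_trans (leq_pred _)).
Qed.

(** One formula [T l] covers all orders. At [l = 0] the differences vanish because both symmetric
    functions are 1, leaving [y phi(y)]; at [l = d] the second one is 0 and the product of the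
    [lambda j] factors out. The two ends are distinct since [d >= 1]. *)
Lemma stein_opE d (m : 'I_d -> nat) (lambda : 'I_d -> R) (phi : R -> R) (y : R) :
  (1 <= d)%N ->
  (y + \sum_(i < d) lambda i * (m i)%:R) * (-1) ^+ d * 2 ^+ d
        * (\prod_(j < d) lambda j) * derive1n d phi y
      + \sum_(1 <= l < d)
          2 ^+ l * (-1) ^+ l
          * (y * elem_sym lambda l
             + \sum_(k < d) lambda k * (m k)%:R
                 * (elem_sym lambda l - elem_sym (del_coord lambda k) l))
          * derive1n l phi y
      + y * phi y = stein_op (stein_poly1 lambda) (stein_poly0 m lambda) phi y.
Proof.
move=> d0; rewrite /stein_op.
rewrite (diffop_widen _ _ (size_stein_poly1 lambda)).
rewrite (diffop_widen _ _ (size_stein_poly0 m lambda)) mulr_sumr -big_split/=.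
have sgn l : (-2) ^+ l = 2 ^+ l * (-1) ^+ l :> R by rewrite -exprMn mulrN1.
pose T l := 2 ^+ l * (-1) ^+ l * (y * elem_sym lambda l
             + \sum_(k < d) lambda k * (m k)%:R
                 * (elem_sym lambda l - elem_sym (del_coord lambda k) l))
          * derive1n l phi y.
rewrite (eq_bigr (fun l : 'I_d.+1 => T l)); last first.
  by move=> l _; rewrite coef_stein_poly1 coef_stein_poly0 sgn /T; ring.
rewrite -(big_mkord xpredT T) big_nat_recr//= [in RHS]big_ltn//=.
have -> : T 0%N = y * phi y.
  rewrite /T !expr0 elem_sym0 derive1n0 big1 ?addr0 ?mul1r ?mulr1// => k _.
  by rewrite elem_sym0 subrr mulr0.
have -> : T d = (y + \sum_(i < d) lambda i * (m i)%:R) * (-1) ^+ d * 2 ^+ d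
        * (\prod_(j < d) lambda j) * derive1n d phi y.
  rewrite /T elem_sym_full.
  have -> : \sum_(k < d) lambda k * (m k)%:R * (\prod_(j < d) lambda j
      - elem_sym (del_coord lambda k) d) =
      (\sum_(k < d) lambda k * (m k)%:R) * \prod_(j < d) lambda j.
    rewrite mulr_suml; apply: eq_bigr => k _.
    by rewrite elem_sym_gt ?subr0// prednK.
  by ring.
by rewrite /T; set S := \sum_(1 <= l < d) _; ring.
Qed.

Lemma symbolD p q (t : R) : symbol (p + q) t = symbol p t + symbol q t.
Proof. by rewrite /symbol rmorphD hornerD. Qed.

Lemma symbolB p q (t : R) : symbol (p - q) t = symbol p t - symbol q t.
Proof. by rewrite /symbol rmorphB hornerD hornerN. Qed.

Lemma symbolM p q (t : R) : symbol (p * q) t = symbol p t * symbol q t.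
Proof. by rewrite /symbol rmorphM hornerM. Qed.

Lemma symbolZ c p (t : R) : symbol (c *: p) t = real_complex R c * symbol p t.
Proof. by rewrite /symbol map_polyZ hornerZ. Qed.

Lemma symbol_linear c (t : R) : symbol (1 - c *: 'X) t = Complex 1 (- (c * t)).
Proof.
rewrite symbolB symbolZ /symbol rmorph1 map_polyX hornerX hornerC.
by apply/eqP; rewrite eq_complex/=; apply/andP; split; apply/eqP; ring.
Qed.

Lemma symbol_sum (J : Type) (r : seq J) (p : J -> {poly R}) (t : R) :
  symbol (\sum_(j <- r) p j) t = \sum_(j <- r) symbol (p j) t.
Proof.
elim/big_rec2: _ => [|j a b _ <-]; first by rewrite /symbol rmorph0 horner0.
exact: symbolD.
Qed.

Lemma symbol_stein_poly1_neq0 d (lambda : 'I_d -> R) t :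
  symbol (stein_poly1 lambda) t != 0.
Proof.
rewrite /stein_poly1; elim/big_rec: _ => [|j p _ IH].
  by rewrite /symbol rmorph1 hornerC oner_neq0.
rewrite symbolM mulf_neq0// symbol_linear eq_complex/= negb_and oner_eq0.
by [].
Qed.

Lemma symbol_stein_poly1_gt0 d (lambda : 'I_d -> R) t :
  0 < complex.Re (symbol (stein_poly1 lambda) t) ^+ 2
    + complex.Im (symbol (stein_poly1 lambda) t) ^+ 2.
Proof.
have := symbol_stein_poly1_neq0 lambda t; set z := symbol _ _ => z0.
rewrite lt_neqAle addr_ge0 ?sqr_ge0// andbT eq_sym; apply: contra z0.
by rewrite paddr_eq0 ?sqr_ge0// !sqrf_eq0 eq_complex.
Qed.

(** With [p = (1 - 2 i lambda_k t) p_k], block [k] contributes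
    [- 2 m_k (t lambda_k)^2 |p_k (i t)|^2]; [lambda_k] enters squared, so its sign is irrelevant. *)
Lemma symbol_stein_poly0_sign d (m : 'I_d -> nat) (lambda : 'I_d -> R) t :
  t * (complex.Re (symbol (stein_poly1 lambda) t)
        * complex.Im (symbol (stein_poly0 m lambda) t)
      - complex.Im (symbol (stein_poly1 lambda) t)
        * complex.Re (symbol (stein_poly0 m lambda) t)) <= 0.
Proof.
rewrite /stein_poly0 symbol_sum Re_sum Im_sum !mulr_sumr -sumrB mulr_sumr.
rewrite -oppr_ge0 -sumrN; apply: sumr_ge0 => k _.
rewrite symbolZ symbolB (stein_poly1E lambda k) symbolM symbol_linear.
rewrite !(ReM, ImM, ReD, ImD, ReN, ImN).
case: (symbol (stein_poly1_del lambda k) t) => x y /=.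
set s := m k; have s0 : 0 <= s%:R :> R by [].
rewrite [leRHS](_ : _ = 2 * s%:R * (t * lambda k) ^+ 2 * (x ^+ 2 + y ^+ 2)); last by ring.
apply: mulr_ge0; last by rewrite addr_ge0 ?sqr_ge0.
by apply: mulr_ge0; [exact: mulr_ge0|exact: sqr_ge0].
Qed.

End elementary_symmetric_coefficients.

(** * The Stein equation as an expectation, and the characterization of the law *)

Section stein_expectation.
Context {R : realType} d (T : measurableType d) (P : probability T R)
  (X : {RV P >-> R}).
Hypothesis X1 : P.-integrable setT (EFin \o X).
Implicit Types (p q : {poly R}) (phi : R -> R).

Lemma schwartz_smooth phi : schwartz phi -> smooth phi.
Proof. by case. Qed.

Lemma schwartz_bounded_derivatives phi : schwartz phi -> bounded_derivatives phi.
Proof.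
move=> [_ H] n; have [C HC] := H 0%N n; exists C => x.
by have := HC x; rewrite expr0 mul1r.
Qed.

Lemma integrable_distribution_id :
  (distribution P X).-integrable setT (EFin \o (id : R -> R)).
Proof.
by apply: integrable_pushforward; rewrite ?preimage_setT//; exact/measurable_EFinP.
Qed.

Lemma integrable_stein_op p q phi : smooth phi -> bounded_derivatives phi ->
  P.-integrable setT (EFin \o (fun w => stein_op p q phi (X w))).
Proof.
move=> sphi /choice[B HB]; have [C HC] := stein_op_linear_growth p q B.
have mS := continuous_measurable_fun (continuous_stein_op (p := p) (q := q) sphi).
apply: (integrable_dominated P (fun w => C.2 + C.1 * `|X w|)).
- apply: integrable_add; first exact: finite_measure_integrable_cst.
  by apply: integrable_scale; exact: (integrable_abse X1).
- exact: (measurableT_comp mS (measurable_funPT X)).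
- by move=> w; exact: HC.
Qed.

Lemma Rintegral_distribution_stein_op p q phi : smooth phi ->
  bounded_derivatives phi ->
  \int[distribution P X]_x stein_op p q phi x = \int[P]_w stein_op p q phi (X w).
Proof.
move=> sphi bphi; rewrite /Rintegral integral_distribution//.
  apply/measurable_EFinP; apply: continuous_measurable_fun.
  exact: continuous_stein_op.
exact: integrable_stein_op.
Qed.

Lemma expectation_stein_op p q phi : smooth phi -> bounded_derivatives phi ->
  'E_P[(fun w => stein_op p q phi (X w))]%E =
  (\int[distribution P X]_x stein_op p q phi x)%:E.
Proof.
move=> sphi bphi; rewrite Rintegral_distribution_stein_op// unlock /Rintegral fineK//.
exact: (integrable_fin_num measurableT (integrable_stein_op p q sphi bphi)).
Qed.

End stein_expectation.

Section block_quadratic_form.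
Context {R : realType} {d q : nat} {m : 'I_d -> nat}.
Hypothesis hmq : (\sum_(k < d) m k = q)%N.
Variable lambda : 'I_d -> R.
Context {disp : measure_display} {Omega : measurableType disp}
  {P : probability Omega R} {N : 'I_q -> {RV P >-> R}}.

Definition coordinate_weight (i : 'I_q) : R :=
  if block_of m i is Some k then lambda k else 0.

(** In the default branch the weight is 0 and the linear factor is 1, so the cofactor has to be the
    whole polynomial. *)
Definition coordinate_poly (i : 'I_q) : {poly R} :=
  if block_of m i is Some k then stein_poly1_del lambda k else stein_poly1 lambda.

Lemma block_quadratic_formE (w : Omega) : quadratic_form N coordinate_weight w =
  \sum_(k < d) \sum_(i < q | in_block m k i) lambda k * ((N i w) ^+ 2 - 1).
Proof.
rewrite -sum_block_of /quadratic_form; apply: eq_bigr => i _.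
by rewrite /coordinate_weight; case: block_of => [k//|]; rewrite mul0r.
Qed.

Lemma coordinate_polyE i : stein_poly1 lambda =
  (1 - (2 * coordinate_weight i) *: 'X) * coordinate_poly i.
Proof.
rewrite /coordinate_weight /coordinate_poly; case: block_of => [k|].
  exact: stein_poly1E.
by rewrite mulr0 scale0r subr0 mul1r.
Qed.

Lemma stein_poly0_blockE : stein_poly0 m lambda =
  - \sum_i (2 * coordinate_weight i ^+ 2) *: ('X * coordinate_poly i).
Proof.
rewrite stein_poly0E; congr (- _).
transitivity (\sum_(k < d) \sum_(i < q | in_block m k i)
    (2 * lambda k ^+ 2) *: ('X * stein_poly1_del lambda k)).
  by apply: eq_bigr => k _; rewrite sumr_const (card_block k hmq).
rewrite -sum_block_of; apply: eq_bigr => i _.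
rewrite /coordinate_weight /coordinate_poly; case: block_of => [k//|].
by rewrite expr0n mulr0 scale0r.
Qed.

End block_quadratic_form.

Theorem corollary2p1 (R : realType) (d q : nat) (hd : (1 <= d)%N)
    (hq : (1 <= q)%N) (m : 'I_d -> nat) (hm : forall k, (0 < m k)%N)
    (hmq : (\sum_(k < d) m k = q)%N)
    (lambda : 'I_d -> R) (hlambda : forall k, lambda k != 0)
    (disp : measure_display) (Omega : measurableType disp)
    (P : probability Omega R)
    (N : 'I_q -> {RV P >-> R})
    (hN : forall i, standard_normal (N i)) (hNind : mutually_independent N)
    (F : {RV P >-> R})
    (hF : forall w : Omega, F w =
      \sum_(k < d)
        \sum_(i < q | (\sum_(j < d | (j < k)%N) m j <= i
                         < \sum_(j < d | (j <= k)%N) m j)%N)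
          lambda k * ((N i w) ^+ 2 - 1))
    (disp' : measure_display) (Omega' : measurableType disp')
    (Q : probability Omega' R)
    (Y : {RV Q >-> R}) (hY : Q.-integrable setT (EFin \o Y)) :
  same_law Y F <->
  forall phi : R -> R, schwartz phi ->
    ('E_Q[(fun w : Omega' =>
      (Y w + \sum_(i < d) lambda i * (m i)%:R) * (-1) ^+ d * 2 ^+ d
        * (\prod_(j < d) lambda j) * derive1n d phi (Y w)
      + \sum_(1 <= l < d)
          2 ^+ l * (-1) ^+ l
          * (Y w * elem_sym lambda l
             + \sum_(k < d) lambda k * (m k)%:R
                 * (elem_sym lambda l - elem_sym (del_coord lambda k) l))
          * derive1n l phi (Y w)
      + Y w * phi (Y w))%R] = 0)%E.
Proof.
set p := stein_poly1 lambda; set r := stein_poly0 m lambda.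
have FE w : F w = quadratic_form N (coordinate_weight (m := m) lambda) w.
  by rewrite block_quadratic_formE hF.
have F1 : P.-integrable setT (EFin \o F).
  rewrite (_ : EFin \o F = EFin \o quadratic_form N (coordinate_weight (m := m) lambda)).
    exact: integrable_quadratic_form.
  by apply/funext => w; rewrite /= FE.
have muY1 := integrable_distribution_id hY.
have muF1 := integrable_distribution_id F1.
have steinF phi : smooth phi -> bounded_derivatives phi ->
    \int[distribution P F]_x stein_op p r phi x = 0.
  move=> sphi bphi; rewrite Rintegral_distribution_stein_op// /r (stein_poly0_blockE hmq).
  under eq_Rintegral do rewrite FE.
  exact: (stein_quadratic_form hN hNind (coordinate_polyE lambda) sphi bphi).
have steinY phi : schwartz phi -> ('E_Q[(fun w : Omega' =>
      (Y w + \sum_(i < d) lambda i * (m i)%:R) * (-1) ^+ d * 2 ^+ d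
        * (\prod_(j < d) lambda j) * derive1n d phi (Y w)
      + \sum_(1 <= l < d)
          2 ^+ l * (-1) ^+ l
          * (Y w * elem_sym lambda l
             + \sum_(k < d) lambda k * (m k)%:R
                 * (elem_sym lambda l - elem_sym (del_coord lambda k) l))
          * derive1n l phi (Y w)
      + Y w * phi (Y w))%R] = (\int[distribution Q Y]_x stein_op p r phi x)%:E)%E.
  move=> Sphi; rewrite -expectation_stein_op//; last 2 first.
  - exact: schwartz_smooth.
  - exact: schwartz_bounded_derivatives.
  by congr expectation; apply/funext => w; rewrite stein_opE.
split=> [YF phi Sphi|H A mA].
  have := steinF phi (schwartz_smooth Sphi) (schwartz_bounded_derivatives Sphi).
  rewrite steinY// => F0; congr EFin; rewrite -[RHS]F0.
  (* Equality of the two laws on measurable sets already gives equality of the integrals. *)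
  by congr fine; apply: eq_measure_integral => A mA _; exact: YF.
have steinY0 phi : smooth phi -> bounded_derivatives phi ->
    \int[distribution Q Y]_x stein_op p r phi x = 0.
  apply: (stein_schwartz_bounded muY1) => f Sf.
  by apply: EFin_inj; rewrite -steinY//; exact: H.
have trig (mu : probability R R) : (forall phi, smooth phi -> bounded_derivatives phi ->
    \int[mu]_x stein_op p r phi x = 0) -> stein_trig p r mu.
  move=> S t; split; apply: S.
  - exact: smooth_cos.
  - exact: bounded_derivatives_cos.
  - exact: smooth_sin.
  - exact: bounded_derivatives_sin.
have chf := stein_trig_unique muY1 muF1 (symbol_stein_poly1_gt0 lambda)
  (symbol_stein_poly0_sign m lambda) (trig _ steinY0) (trig _ steinF).
by apply: characteristic_function_unique => // t; have [] := chf t.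
Qed.
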